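(* Let $K$ be a knot in $S^3$ and let $\Sigma_2(K)$ denote the double cover of $S^3$ branched along $K$. If every homomorphism $\pi_1(\Sigma_2(K)) \to SO(3)$ has cyclic image, then every representation in $R(K;\mathbf{i})$ is binary dihedral; that is, $K$ is $SU(2)$-simple.
   Context: Identify $SU(2)$ with the group of unit quaternions. For a knot $K \subset S^3$ with meridian $m \in \pi_1(S^3\setminus K)$, the space of meridian-traceless representations is $$R(K;\mathbf{i}) = \{\rho \in \mathrm{Hom}(\pi_1(S^3\setminus K), SU(2)) \mid \rho(m) \text{ is conjugate in } SU(2) \text{ to } \mathbf{i}\},$$ where $\mathbf{i}$ is the quaternion unit (equivalently, $\rho(m)$ is a purely imaginary unit quaternion, i.e. a trace-free element of $SU(2)$). A representation in $SO(3)$ is called dihedral if its image is contained in a dihedral subgroup of $SO(3)$, i.e. a group of elements preserving a fixed plane and acting on it by rotations and reflections of that plane. A representation in $SU(2)$ is called binary dihedral if its composition with the double covering $SU(2)\to SO(3)$ is dihedral. (Abelian representations are thus in particular binary dihedral.) A knot $K$ is called $SU(2)$-simple if $R(K;\mathbf{i})$ contains only binary dihedral representations. *)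

(* Defs.v *)
From HB Require Import structures.
From mathcomp Require Import all_boot all_order all_algebra generic_quotient.
From mathcomp Require Import all_classical all_reals all_analysis homotopy ring lra.

Set Implicit Arguments.
Unset Strict Implicit.
Unset Printing Implicit Defensive.

Import Order.TTheory GRing.Theory Num.Theory numFieldNormedType.Exports.

Local Open Scope classical_set_scope.
Local Open Scope ring_scope.
Local Open Scope quotient_scope.

Section unit_interval.
Context (R : realType).

Definition I01 : Type := set_type (`[0%R, 1%R]%classic : set R).
HB.instance Definition _ :=
  Topological.copy I01 (set_type (`[0%R, 1%R]%classic : set R)).

Definition clamp01 (t : R) : R := Num.max 0 (Num.min 1 t).

Lemma clamp01_in t : clamp01 t \in (`[0%R, 1%R]%classic : set R).
Proof.
rewrite /clamp01 inE/= in_itv/=.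
by rewrite le_max lexx/= ge_max ler01/= ge_min lexx.
Qed.

Definition toI (t : R) : I01 := SigSub (clamp01_in t).

Lemma I01P (t : I01) : 0 <= \val t <= 1.
Proof. by case: t => t /= ; rewrite inE/= in_itv. Qed.

Lemma valI (t : I01) : toI (\val t) = t.
Proof.
apply: val_inj; rewrite /= /clamp01; case/andP: (I01P t) => t0 t1.
by rewrite min_r// max_r.
Qed.

Lemma toI_continuous : continuous toI.
Proof.
apply: continuous_comp_initial => t /=.
apply: (@continuous_max R R); first exact: cvg_cst.
apply: (@continuous_min R R); first exact: cvg_cst.
exact: cvg_id.
Qed.

Lemma val_continuous : continuous (\val : I01 -> R).
Proof. exact: initial_continuous. Qed.

Lemma toI01 : toI 0 <> toI 1.
Proof.
move=> /(congr1 \val)/=; rewrite /clamp01 minxx (min_r ler01) maxxx (max_r ler01).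
by move/eqP; rewrite eq_sym oner_eq0.
Qed.

HB.instance Definition _ := @isBiPointed.Build I01 (toI 0) (toI 1) (introN eqP toI01).

End unit_interval.

Section real_continuous.
Context (R : realType) (Z : topologicalType).
Implicit Types F G : Z -> R.

Lemma continuous_cstR (c : R) : continuous (fun _ : Z => c).
Proof. by move=> p; exact: cvg_cst. Qed.

Lemma continuous_addR F G : continuous F -> continuous G ->
  continuous (fun p => F p + G p).
Proof. by move=> cF cG p; apply: cvgD; [exact: cF|exact: cG]. Qed.

Lemma continuous_subR F G : continuous F -> continuous G ->
  continuous (fun p => F p - G p).
Proof. by move=> cF cG p; apply: cvgB; [exact: cF|exact: cG]. Qed.

Lemma continuous_mulR F G : continuous F -> continuous G ->
  continuous (fun p => F p * G p).
Proof. by move=> cF cG p; apply: cvgM; [exact: cF|exact: cG]. Qed.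

Lemma continuous_minR F G : continuous F -> continuous G ->
  continuous (fun p => Num.min (F p) (G p)).
Proof.
by move=> cF cG p; apply: (@continuous_min R Z); [exact: cF|exact: cG].
Qed.

Lemma continuous_maxR F G : continuous F -> continuous G ->
  continuous (fun p => Num.max (F p) (G p)).
Proof.
by move=> cF cG p; apply: (@continuous_max R Z); [exact: cF|exact: cG].
Qed.

Lemma continuous_compR (T : topologicalType) (F : Z -> R) (h : R -> T) :
  continuous F -> continuous h -> continuous (fun p => h (F p)).
Proof. by move=> cF ch p; apply: continuous_comp; [exact: cF|exact: ch]. Qed.

End real_continuous.

Section paths.
Context (R : realType) (T : topologicalType).
Implicit Types x y z w : T.

(* f, extended to the whole line by its end points *)
Definition pathR x y (f : {path I01 R from x to y}) (t : R) : T := f (toI t).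

Lemma pathR_continuous x y (f : {path I01 R from x to y}) :
  continuous (pathR f).
Proof.
by move=> t; apply: continuous_comp; [exact: toI_continuous|exact: cts_fun].
Qed.

Lemma pathR_val x y (f : {path I01 R from x to y}) t : pathR f (\val t) = f t.
Proof. by rewrite /pathR valI. Qed.

Lemma pathR_le0 x y (f : {path I01 R from x to y}) (t : R) :
  t <= 0 -> pathR f t = x.
Proof.
move=> t0; rewrite /pathR (_ : toI t = zero) ?path_zero//.
apply: val_inj => /=; rewrite /clamp01 min_r ?(le_trans t0)//.
by rewrite max_l// min_r// maxxx.
Qed.

Lemma pathR_ge1 x y (f : {path I01 R from x to y}) (t : R) :
  1 <= t -> pathR f t = y.
Proof.
move=> t1; rewrite /pathR (_ : toI t = one) ?path_one//.
by apply: val_inj => /=; rewrite /clamp01 min_l// minxx.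
Qed.

Lemma glue_continuous (Z : topologicalType) (u : Z -> R) (c : R)
    (F G : Z -> T) :
  continuous u -> continuous F -> continuous G ->
  (forall p, u p = c -> F p = G p) ->
  continuous (fun p => if u p <= c then F p else G p).
Proof.
move=> cu cF cG FG p; rewrite /continuous_at.
have [upc|upc|upc] := ltgtP (u p) c.
- move=> U nU; change (\forall a \near p, U (if u a <= c then F a else G a)); near=> a.
  have /ltW/= -> : u a < c by near: a; exact: (cu p _ (lt_nbhsl upc)).
  by near: a; exact: (cF p _ nU).
- move=> U nU; change (\forall a \near p, U (if u a <= c then F a else G a)); near=> a.
  have ca : c < u a by near: a; exact: (cu p _ (lt_nbhsr upc)).
  by rewrite leNgt ca/=; near: a; exact: (cG p _ nU).
- move=> U nU; have nU' : nbhs (G p) U by rewrite -FG.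
  change (\forall a \near p, U (if u a <= c then F a else G a)).
  near=> a; case: ifP => _.
    by near: a; exact: (cF p _ nU).
  by near: a; exact: (cG p _ nU').
Unshelve. all: by end_near. Qed.

Section concat.
Context (x y z : T) (f : {path I01 R from x to y}) (g : {path I01 R from y to z}).

Definition concat_fun (t : I01 R) : T :=
  if \val t <= 2^-1 then pathR f (2 * \val t) else pathR g (2 * \val t - 1).

Lemma concat_continuous : continuous concat_fun.
Proof.
have cv := @val_continuous R.
have c2 : continuous (fun t : I01 R => 2 * \val t).
  by apply: continuous_mulR => //; exact: continuous_cstR.
apply: glue_continuous => //.
- by apply: continuous_compR => //; exact: pathR_continuous.
- apply: continuous_compR; last exact: pathR_continuous.
  by apply: continuous_subR => //; exact: continuous_cstR.
- by move=> t ->; rewrite pathR_ge1 ?pathR_le0//; lra.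
Qed.

Lemma concat_zero : concat_fun zero = x.
Proof.
rewrite /concat_fun /= /clamp01 min_r// maxxx ifT; last by lra.
by rewrite pathR_le0// mulr0.
Qed.

Lemma concat_one : concat_fun one = z.
Proof.
rewrite /concat_fun /= /clamp01 minxx max_r// ifF; last by lra.
by rewrite pathR_ge1//; lra.
Qed.

Definition concat : {path I01 R from x to z} :=
  mk_path concat_continuous concat_zero concat_one.
End concat.

Section reverse.
Context (x y : T) (f : {path I01 R from x to y}).

Definition reverse_fun (t : I01 R) : T := pathR f (1 - \val t).

Lemma reverse_continuous : continuous reverse_fun.
Proof.
apply: continuous_compR; last exact: pathR_continuous.
by apply: continuous_subR; [exact: continuous_cstR|exact: val_continuous].
Qed.

Lemma reverse_zero : reverse_fun zero = y.
Proof.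
by rewrite /reverse_fun /= /clamp01 min_r// maxxx subr0 pathR_ge1.
Qed.

Lemma reverse_one : reverse_fun one = x.
Proof.
by rewrite /reverse_fun /= /clamp01 minxx max_r// subrr pathR_le0.
Qed.

Definition reverse : {path I01 R from y to x} :=
  mk_path reverse_continuous reverse_zero reverse_one.
End reverse.

Definition path_homotopic x y (f g : {path I01 R from x to y}) : Prop :=
  exists h : I01 R * I01 R -> T, [/\ continuous h,
    forall t, h (t, zero) = f t, forall t, h (t, one) = g t,
    forall s, h (zero, s) = x & forall s, h (one, s) = y].

Lemma reparam_homotopic a b x y (f : {path I01 R from a to b})
    (g h : {path I01 R from x to y}) (phi psi : R -> R) :
  continuous phi -> continuous psi ->
  (phi 0 = psi 0) -> (phi 1 = psi 1) ->
  (forall t, g t = pathR f (phi (\val t))) ->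
  (forall t, h t = pathR f (psi (\val t))) -> path_homotopic g h.
Proof.
move=> cphi cpsi e0 e1 gE hE.
have v0 : \val (zero : I01 R) = 0 :> R by rewrite /= /clamp01 min_r// maxxx.
have v1 : \val (one : I01 R) = 1 :> R by rewrite /= /clamp01 minxx max_r.
exists (fun ts => pathR f ((1 - \val ts.2) * phi (\val ts.1)
                           + \val ts.2 * psi (\val ts.1))); split.
- have c1 : continuous (fun ts : I01 R * I01 R => \val ts.1).
    by move=> ts; apply: (@continuous_comp _ _ _ fst);
      [exact: cvg_fst|exact: val_continuous].
  have c2 : continuous (fun ts : I01 R * I01 R => \val ts.2).
    by move=> ts; apply: (@continuous_comp _ _ _ snd);
      [exact: cvg_snd|exact: val_continuous].
  apply: continuous_compR; last exact: pathR_continuous.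
  apply: continuous_addR; apply: continuous_mulR => //.
  + by apply: continuous_subR => //; exact: continuous_cstR.
  + exact: continuous_compR.
  + exact: continuous_compR.
- by move=> t; cbv beta; rewrite [(_, _).2]/= v0 subr0 mul1r mul0r addr0 gE.
- by move=> t; cbv beta; rewrite [(_, _).2]/= v1 subrr mul1r mul0r add0r hE.
- move=> s; cbv beta; rewrite [(_, _).1]/= v0 -e0 -mulrDl subrK mul1r.
  by rewrite -[in phi _]v0 -gE path_zero.
- move=> s; cbv beta; rewrite [(_, _).1]/= v1 -e1 -mulrDl subrK mul1r.
  by rewrite -[in phi _]v1 -gE path_one.
Qed.

Lemma val_zero : \val (zero : I01 R) = 0.
Proof. by rewrite /= /clamp01 min_r// maxxx. Qed.

Lemma val_one : \val (one : I01 R) = 1.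
Proof. by rewrite /= /clamp01 minxx max_r. Qed.

Lemma toI_le0 (t : R) : t <= 0 -> toI t = zero.
Proof.
move=> t0; apply: val_inj => /=; rewrite /clamp01 min_r ?(le_trans t0)//.
by rewrite max_l// min_r// maxxx.
Qed.

Lemma toI_ge1 (t : R) : 1 <= t -> toI t = one.
Proof. by move=> t1; apply: val_inj => /=; rewrite /clamp01 min_l// minxx. Qed.

Lemma continuous_pair (Z X Y : topologicalType) (F : Z -> X) (G : Z -> Y) :
  continuous F -> continuous G -> continuous (fun p => (F p, G p)).
Proof. by move=> cF cG p; apply: cvg_pair; [exact: cF|exact: cG]. Qed.

Lemma continuous_fst (X Y : topologicalType) :
  continuous (fun p : X * Y => p.1).
Proof. by move=> p; exact: cvg_fst. Qed.

Lemma continuous_snd (X Y : topologicalType) :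
  continuous (fun p : X * Y => p.2).
Proof. by move=> p; exact: cvg_snd. Qed.

Lemma continuous_comp_fun (X Y Z : topologicalType) (F : X -> Y) (G : Y -> Z) :
  continuous F -> continuous G -> continuous (fun p => G (F p)).
Proof. by move=> cF cG p; apply: continuous_comp; [exact: cF|exact: cG]. Qed.

Lemma continuous_val1 :
  continuous (fun ts : I01 R * I01 R => \val ts.1).
Proof.
by apply: continuous_comp_fun (@val_continuous R); exact: continuous_fst.
Qed.

Lemma continuous_val2 :
  continuous (fun ts : I01 R * I01 R => \val ts.2).
Proof.
by apply: continuous_comp_fun (@val_continuous R); exact: continuous_snd.
Qed.

Lemma path_homotopic_refl x y (f : {path I01 R from x to y}) :
  path_homotopic f f.
Proof.
exists (fun ts => f ts.1); split => //=.
- by apply: continuous_comp_fun; [exact: continuous_fst|exact: cts_fun].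
- by move=> s; rewrite path_zero.
- by move=> s; rewrite path_one.
Qed.

Lemma path_homotopic_sym x y (f g : {path I01 R from x to y}) :
  path_homotopic f g -> path_homotopic g f.
Proof.
move=> [h [ch h0 h1 hx hy]].
exists (fun ts => h (ts.1, toI (1 - \val ts.2))); split.
- apply: (continuous_comp_fun _ ch).
  apply: continuous_pair; first exact: continuous_fst.
  apply: continuous_compR; last exact: toI_continuous.
  by apply: continuous_subR; [exact: continuous_cstR|exact: continuous_val2].
- by move=> t; rewrite /snd val_zero subr0 h1.
- by move=> t; rewrite /snd val_one subrr h0.
- by move=> s; rewrite hx.
- by move=> s; rewrite hy.
Qed.

Lemma path_homotopic_trans x y (f g k : {path I01 R from x to y}) :
  path_homotopic f g -> path_homotopic g k -> path_homotopic f k.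
Proof.
move=> [h [ch h0 h1 hx hy]] [h' [ch' h0' h1' hx' hy']].
have c2 : continuous (fun ts : I01 R * I01 R => 2 * \val ts.2).
  by apply: continuous_mulR; [exact: continuous_cstR|exact: continuous_val2].
exists (fun ts => if \val ts.2 <= 2^-1 then h (ts.1, toI (2 * \val ts.2))
                  else h' (ts.1, toI (2 * \val ts.2 - 1))); split.
- apply: glue_continuous; first exact: continuous_val2.
  + apply: (continuous_comp_fun _ ch).
    apply: continuous_pair; first exact: continuous_fst.
    by apply: continuous_compR => //; exact: toI_continuous.
  + apply: (continuous_comp_fun _ ch').
    apply: continuous_pair; first exact: continuous_fst.
    apply: continuous_compR; last exact: toI_continuous.
    by apply: continuous_subR => //; exact: continuous_cstR.
  + by move=> ts ->; rewrite toI_ge1 ?toI_le0 ?h1 ?h0'//; lra.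
- move=> t; rewrite /snd val_zero ifT; last by lra.
  by rewrite mulr0 h0.
- move=> t; rewrite /snd val_one ifF; last by lra.
  by rewrite toI_ge1 ?h1'//; lra.
- by move=> s; rewrite hx hx' if_same.
- by move=> s; rewrite hy hy' if_same.
Qed.

Lemma concat_homotopic x y z (f f' : {path I01 R from x to y})
    (g g' : {path I01 R from y to z}) :
  path_homotopic f f' -> path_homotopic g g' ->
  path_homotopic (concat f g) (concat f' g').
Proof.
move=> [h [ch h0 h1 hx hy]] [h' [ch' h0' h1' hx' hy']].
have c2 : continuous (fun ts : I01 R * I01 R => 2 * \val ts.1).
  by apply: continuous_mulR; [exact: continuous_cstR|exact: continuous_val1].
exists (fun ts => if \val ts.1 <= 2^-1 then h (toI (2 * \val ts.1), ts.2)
                  else h' (toI (2 * \val ts.1 - 1), ts.2)); split.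
- apply: glue_continuous; first exact: continuous_val1.
  + apply: (continuous_comp_fun _ ch).
    apply: continuous_pair; last exact: continuous_snd.
    by apply: continuous_compR => //; exact: toI_continuous.
  + apply: (continuous_comp_fun _ ch').
    apply: continuous_pair; last exact: continuous_snd.
    apply: continuous_compR; last exact: toI_continuous.
    by apply: continuous_subR => //; exact: continuous_cstR.
  + by move=> ts ->; rewrite toI_ge1 ?toI_le0 ?hx' ?hy//; lra.
- by move=> t; rewrite /fst h0 h0'.
- by move=> t; rewrite /fst h1 h1'.
- move=> s; rewrite /fst val_zero ifT; last by lra.
  by rewrite mulr0 hx.
- move=> s; rewrite /fst val_one ifF; last by lra.
  by rewrite toI_ge1 ?hy'//; lra.
Qed.

Lemma reverse_homotopic x y (f g : {path I01 R from x to y}) :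
  path_homotopic f g -> path_homotopic (reverse f) (reverse g).
Proof.
move=> [h [ch h0 h1 hx hy]].
exists (fun ts => h (toI (1 - \val ts.1), ts.2)); split.
- apply: (continuous_comp_fun _ ch).
  apply: continuous_pair; last exact: continuous_snd.
  apply: continuous_compR; last exact: toI_continuous.
  by apply: continuous_subR; [exact: continuous_cstR|exact: continuous_val1].
- by move=> t; rewrite /fst h0.
- by move=> t; rewrite /fst h1.
- by move=> s; rewrite /fst val_zero subr0 hy.
- by move=> s; rewrite /fst val_one subrr hx.
Qed.

Definition const_path x : {path I01 R from x to x} := cst x.

Lemma clampK (t : R) : 0 <= t <= 1 -> \val (toI t) = t.
Proof. by move=> /andP[t0 t1]; rewrite /= /clamp01 min_r// max_r. Qed.

Lemma pathR_concat x y z (f : {path I01 R from x to y})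
    (g : {path I01 R from y to z}) (t : R) :
  pathR (concat f g) t =
  if t <= 2^-1 then pathR f (2 * t) else pathR g (2 * t - 1).
Proof.
have [t0|t0] := leP t 0.
  rewrite pathR_le0// ifT; last by lra.
  by rewrite pathR_le0//; lra.
have [t1|t1] := leP 1 t.
  rewrite pathR_ge1// ifF; last by lra.
  by rewrite pathR_ge1//; lra.
by rewrite {1}/pathR /= /mk_path /concat_fun clampK// (ltW t0) (ltW t1).
Qed.

Lemma pathR_reverse x y (f : {path I01 R from x to y}) (t : R) :
  pathR (reverse f) t = pathR f (1 - t).
Proof.
have [t0|t0] := leP t 0.
  by rewrite pathR_le0// pathR_ge1//; lra.
have [t1|t1] := leP 1 t.
  by rewrite pathR_ge1// pathR_le0//; lra.
by rewrite {1}/pathR /= /mk_path /reverse_fun clampK// (ltW t0) (ltW t1).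
Qed.

Lemma affine_continuous (a b : R) : continuous (fun t : R => a * t + b).
Proof.
apply: continuous_addR; last exact: continuous_cstR.
by apply: continuous_mulR; [exact: continuous_cstR|move=> t; exact: cvg_id].
Qed.

Lemma concatA x y z w (f : {path I01 R from x to y})
    (g : {path I01 R from y to z}) (h : {path I01 R from z to w}) :
  path_homotopic (concat (concat f g) h) (concat f (concat g h)).
Proof.
apply: (@reparam_homotopic _ _ _ _ (concat f (concat g h)) _ _
  (fun t => Num.min (2^-1 * t + 2^-1) (Num.min (2 * t + 0) (1 * t + 4^-1)))
  (fun t => 1 * t + 0)).
- by do 2?[apply: continuous_minR]; exact: affine_continuous.
- exact: affine_continuous.
- rewrite (min_l (_ : 2 * 0 + 0 <= 1 * 0 + 4^-1)); last by lra.
  by rewrite min_r; lra.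
- rewrite (min_r (_ : 1 * 1 + 4^-1 <= 2 * 1 + 0)); last by lra.
  by rewrite min_l; lra.
- move=> t; have /andP[t0 t1] := I01P t.
  rewrite -pathR_val !pathR_concat; set s := \val t in t0 t1 *.
  have [s2|s2] := leP s 2^-1; last first.
    rewrite (min_l (_ : 2^-1 * s + 2^-1 <= _)); last by rewrite le_min; lra.
    rewrite ifF; last by lra.
    by rewrite ifF; [congr pathR; lra|lra].
  rewrite (min_r (_ : _ <= 2^-1 * s + 2^-1)); last by rewrite ge_min; lra.
  have [s4|s4] := leP (2 * s) 2^-1.
    rewrite min_l; last by lra.
    by rewrite ifT; [congr pathR; lra|lra].
  rewrite min_r; last by lra.
  rewrite ifF; last by lra.
  by rewrite ifT; [congr pathR; lra|lra].
- by move=> t; rewrite mul1r addr0 pathR_val.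
Qed.

Lemma concat_constl x y (f : {path I01 R from x to y}) :
  path_homotopic (concat (const_path x) f) f.
Proof.
apply: (@reparam_homotopic _ _ _ _ f _ _
  (fun t => Num.max 0 (2 * t + - 1)) (fun t => 1 * t + 0)).
- by apply: continuous_maxR; [exact: continuous_cstR|exact: affine_continuous].
- exact: affine_continuous.
- by rewrite !mulr0 max_l; lra.
- by rewrite max_r; lra.
- move=> t; rewrite -pathR_val pathR_concat; set s := \val t.
  have [s2|s2] := leP s 2^-1; last by rewrite max_r//; lra.
  by rewrite max_l ?[RHS]pathR_le0//; lra.
- by move=> t; rewrite mul1r addr0 pathR_val.
Qed.

Lemma concat_constr x y (f : {path I01 R from x to y}) :
  path_homotopic (concat f (const_path y)) f.
Proof.
apply: (@reparam_homotopic _ _ _ _ f _ _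
  (fun t => Num.min 1 (2 * t + 0)) (fun t => 1 * t + 0)).
- by apply: continuous_minR; [exact: continuous_cstR|exact: affine_continuous].
- exact: affine_continuous.
- by rewrite !mulr0 min_r; lra.
- by rewrite min_l; lra.
- move=> t; rewrite -pathR_val pathR_concat; set s := \val t.
  have [s2|s2] := leP s 2^-1; first by rewrite min_r ?addr0//; lra.
  by rewrite min_l ?[RHS]pathR_ge1//; lra.
- by move=> t; rewrite mul1r addr0 pathR_val.
Qed.

Lemma concat_reverser x y (f : {path I01 R from x to y}) :
  path_homotopic (concat f (reverse f)) (const_path x).
Proof.
apply: (@reparam_homotopic _ _ _ _ f _ _
  (fun t => Num.min (2 * t + 0) (- 2 * t + 2)) (fun t => 0 * t + 0)).
- by apply: continuous_minR; exact: affine_continuous.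
- exact: affine_continuous.
- by rewrite /Num.min; case: ltP => ?; lra.
- by rewrite /Num.min; case: ltP => ?; lra.
- move=> t; rewrite -pathR_val pathR_concat; set s := \val t.
  have [s2|s2] := leP s 2^-1; first by rewrite min_l ?addr0//; lra.
  by rewrite pathR_reverse min_r; [congr pathR; lra|lra].
- by move=> t; rewrite mul0r addr0 pathR_le0.
Qed.

Lemma reverseK x y (f : {path I01 R from x to y}) :
  path_homotopic (reverse (reverse f)) f.
Proof.
apply: (@reparam_homotopic _ _ _ _ f _ _
  (fun t => 1 * t + 0) (fun t => 1 * t + 0)) => //.
- exact: affine_continuous.
- exact: affine_continuous.
- move=> t; rewrite -pathR_val !pathR_reverse; congr pathR; lra.
- by move=> t; rewrite mul1r addr0 pathR_val.
Qed.

Lemma concat_reversel x y (f : {path I01 R from x to y}) :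
  path_homotopic (concat (reverse f) f) (const_path y).
Proof.
apply: path_homotopic_trans (concat_reverser (reverse f)).
apply: concat_homotopic; first exact: path_homotopic_refl.
by apply: path_homotopic_sym; exact: reverseK.
Qed.


Definition path_connected : Prop :=
  forall x y, exists f : {path I01 R from x to y}, True.

End paths.

Section fundamental_group.
Context (R : realType) (T : topologicalType) (x : T).

Definition loop_rel (f g : {path I01 R from x to x}) : bool :=
  `[< path_homotopic f g >].

Lemma loop_rel_equiv : equiv_class_of loop_rel.
Proof.
split=> [f|f g|g f h]; rewrite /loop_rel.
- by apply/asboolP; exact: path_homotopic_refl.
- by apply/asboolP/asboolP => ?; exact: path_homotopic_sym.
- move=> /asboolP fg /asboolP gh; apply/asboolP.
  exact: path_homotopic_trans gh.
Qed.

Canonical loop_equiv := EquivRelPack loop_rel_equiv.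

Definition pi1 : Type := {eq_quot loop_equiv}.
HB.instance Definition _ := Choice.on pi1.

Definition homotopy_class (f : {path I01 R from x to x}) : pi1 :=
  \pi_({eq_quot loop_equiv}) f.

Lemma homotopy_classP f g :
  homotopy_class f = homotopy_class g <-> path_homotopic f g.
Proof.
split=> [/eqquotP/asboolP//|fg].
by apply/eqquotP/asboolP.
Qed.

Lemma homotopy_class_repr (a : pi1) :
  homotopy_class (repr (a : {eq_quot loop_equiv})) = a.
Proof. exact: reprK. Qed.

Lemma pi1_ind (P : pi1 -> Prop) : (forall f, P (homotopy_class f)) ->
  forall a, P a.
Proof. by move=> Pf a; rewrite -(homotopy_class_repr a). Qed.

Definition pi1_mul (a b : pi1) : pi1 :=
  homotopy_class (concat (repr (a : {eq_quot loop_equiv}))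
                         (repr (b : {eq_quot loop_equiv}))).
Definition pi1_inv (a : pi1) : pi1 :=
  homotopy_class (reverse (repr (a : {eq_quot loop_equiv}))).
Definition pi1_one : pi1 := homotopy_class (const_path R x).

Lemma pi1_mulE f g :
  pi1_mul (homotopy_class f) (homotopy_class g) = homotopy_class (concat f g).
Proof.
apply/homotopy_classP; apply: concat_homotopic; apply/homotopy_classP;
exact: homotopy_class_repr.
Qed.

Lemma pi1_invE f : pi1_inv (homotopy_class f) = homotopy_class (reverse f).
Proof.
apply/homotopy_classP; apply: reverse_homotopic; apply/homotopy_classP.
exact: homotopy_class_repr.
Qed.

Lemma pi1_mulA : associative pi1_mul.
Proof.
elim/pi1_ind => f; elim/pi1_ind => g; elim/pi1_ind => h.
rewrite !pi1_mulE; apply/esym/homotopy_classP; exact: concatA.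
Qed.

Lemma pi1_mul1 : left_id pi1_one pi1_mul.
Proof.
elim/pi1_ind => f; rewrite pi1_mulE; apply/homotopy_classP.
exact: concat_constl.
Qed.

Lemma pi1_mulr1 : right_id pi1_one pi1_mul.
Proof.
elim/pi1_ind => f; rewrite pi1_mulE; apply/homotopy_classP.
exact: concat_constr.
Qed.

Lemma pi1_mulV : left_inverse pi1_one pi1_inv pi1_mul.
Proof.
elim/pi1_ind => f; rewrite pi1_invE pi1_mulE; apply/homotopy_classP.
exact: concat_reversel.
Qed.

Lemma pi1_mulrV : right_inverse pi1_one pi1_inv pi1_mul.
Proof.
elim/pi1_ind => f; rewrite pi1_invE pi1_mulE; apply/homotopy_classP.
exact: concat_reverser.
Qed.

HB.instance Definition _ :=
  isGroup.Build pi1 pi1_mulA pi1_mul1 pi1_mulr1 pi1_mulV pi1_mulrV.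

Lemma homotopy_classM f g :
  (homotopy_class f * homotopy_class g)%g = homotopy_class (concat f g).
Proof. exact: pi1_mulE. Qed.

Lemma homotopy_classV f :
  ((homotopy_class f)^-1)%g = homotopy_class (reverse f).
Proof. exact: pi1_invE. Qed.

Lemma homotopy_class1 : homotopy_class (const_path R x) = 1%g.
Proof. by []. Qed.

End fundamental_group.

Section quaternions.
Context (R : realType).

Record quaternion : Type := Quat { qre : R; qi : R; qj : R; qk : R }.

Implicit Types p q r : quaternion.

Definition qmul p q : quaternion :=
  Quat (qre p * qre q - qi p * qi q - qj p * qj q - qk p * qk q)
       (qre p * qi q + qi p * qre q + qj p * qk q - qk p * qj q)
       (qre p * qj q - qi p * qk q + qj p * qre q + qk p * qi q)
       (qre p * qk q + qi p * qj q - qj p * qi q + qk p * qre q).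

Definition qone : quaternion := Quat 1 0 0 0.

Definition qconj q : quaternion := Quat (qre q) (- qi q) (- qj q) (- qk q).

Definition qnorm2 q : R := qre q ^+ 2 + qi q ^+ 2 + qj q ^+ 2 + qk q ^+ 2.

Lemma qmulA p q r : qmul p (qmul q r) = qmul (qmul p q) r.
Proof.
by case: p q r => [a b c d] [e f g h] [i j k l]; rewrite /qmul/=; congr Quat; ring.
Qed.

Lemma qmul1 q : qmul qone q = q.
Proof. by case: q => a b c d; rewrite /qmul/=; congr Quat; ring. Qed.

Lemma qmulr1 q : qmul q qone = q.
Proof. by case: q => a b c d; rewrite /qmul/=; congr Quat; ring. Qed.

Lemma qmulV q : qmul (qconj q) q = Quat (qnorm2 q) 0 0 0.
Proof. by case: q => a b c d; rewrite /qmul/qnorm2/=; congr Quat; ring. Qed.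

Lemma qmulrV q : qmul q (qconj q) = Quat (qnorm2 q) 0 0 0.
Proof. by case: q => a b c d; rewrite /qmul/qnorm2/=; congr Quat; ring. Qed.

Lemma qnorm2M p q : qnorm2 (qmul p q) = qnorm2 p * qnorm2 q.
Proof. by case: p q => [a b c d] [e f g h]; rewrite /qnorm2/=; ring. Qed.

Lemma qnorm2_conj q : qnorm2 (qconj q) = qnorm2 q.
Proof. by case: q => a b c d; rewrite /qnorm2/=; ring. Qed.

Lemma qnorm2_one : qnorm2 qone = 1.
Proof. by rewrite /qnorm2/=; ring. Qed.

Record SU2 : Type := UnitQuat { su2_val :> quaternion; _ : qnorm2 su2_val = 1 }.

HB.instance Definition _ := gen_eqMixin SU2.
HB.instance Definition _ := gen_choiceMixin SU2.

Lemma su2_norm (u : SU2) : qnorm2 u = 1.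
Proof. by case: u. Qed.

Lemma su2_inj (u v : SU2) : su2_val u = su2_val v -> u = v.
Proof.
case: u v => [u u1] [v v1] /= uv; move: u1 v1; rewrite uv => u1 v1.
by rewrite (Prop_irrelevance u1 v1).
Qed.

Lemma su2_mul_subproof (u v : SU2) : qnorm2 (qmul u v) = 1.
Proof. by rewrite qnorm2M !su2_norm mulr1. Qed.

Lemma su2_inv_subproof (u : SU2) : qnorm2 (qconj u) = 1.
Proof. by rewrite qnorm2_conj su2_norm. Qed.

Definition su2_mul (u v : SU2) : SU2 := UnitQuat (su2_mul_subproof u v).
Definition su2_inv (u : SU2) : SU2 := UnitQuat (su2_inv_subproof u).
Definition su2_one : SU2 := UnitQuat qnorm2_one.

Lemma su2_mulA : associative su2_mul.
Proof. by move=> u v w; apply: su2_inj; exact: qmulA. Qed.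
Lemma su2_mul1 : left_id su2_one su2_mul.
Proof. by move=> u; apply: su2_inj; exact: qmul1. Qed.
Lemma su2_mulr1 : right_id su2_one su2_mul.
Proof. by move=> u; apply: su2_inj; exact: qmulr1. Qed.
Lemma su2_mulV : left_inverse su2_one su2_inv su2_mul.
Proof. by move=> u; apply: su2_inj; rewrite /= qmulV su2_norm. Qed.
Lemma su2_mulrV : right_inverse su2_one su2_inv su2_mul.
Proof. by move=> u; apply: su2_inj; rewrite /= qmulrV su2_norm. Qed.

HB.instance Definition _ :=
  isGroup.Build SU2 su2_mulA su2_mul1 su2_mulr1 su2_mulV su2_mulrV.

Lemma qnorm2_i : qnorm2 (Quat 0 1 0 0) = 1.
Proof. by rewrite /qnorm2/=; ring. Qed.

Definition su2_i : SU2 := UnitQuat qnorm2_i.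

End quaternions.

Section rotations.
Context (R : realType).

Record SO3 : Type := Rotation {
  so3_val :> 'M[R]_3;
  _ : so3_val^T *m so3_val = 1%:M /\ \det so3_val = 1
}.

HB.instance Definition _ := gen_eqMixin SO3.
HB.instance Definition _ := gen_choiceMixin SO3.

Implicit Types A B : SO3.

Lemma so3_orth A : A^T *m A = 1%:M. Proof. by case: A => A /= []. Qed.
Lemma so3_det A : \det A = 1. Proof. by case: A => A /= []. Qed.
Lemma so3_orthC A : A *m A^T = 1%:M.
Proof. by apply: mulmx1C; exact: so3_orth. Qed.

Lemma so3_inj A B : A = B :> 'M[R]_3 -> A = B.
Proof.
case: A B => [A A1] [B B1] /= AB; move: A1 B1; rewrite AB => A1 B1.
by rewrite (Prop_irrelevance A1 B1).
Qed.

Lemma so3_mul_subproof A B :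
  (A *m B)^T *m (A *m B) = 1%:M /\ \det (A *m B) = 1.
Proof.
split; last by rewrite det_mulmx !so3_det mulr1.
by rewrite trmx_mul mulmxA -(mulmxA B^T) so3_orth mulmx1 so3_orth.
Qed.

Lemma so3_inv_subproof A : (A^T)^T *m A^T = 1%:M /\ \det A^T = 1.
Proof. by rewrite trmxK so3_orthC det_tr so3_det. Qed.

Lemma so3_one_subproof : (1%:M : 'M[R]_3)^T *m 1%:M = 1%:M /\
  \det (1%:M : 'M[R]_3) = 1.
Proof. by rewrite trmx1 mulmx1 det1. Qed.

Definition so3_mul A B : SO3 := Rotation (so3_mul_subproof A B).
Definition so3_inv A : SO3 := Rotation (so3_inv_subproof A).
Definition so3_one : SO3 := Rotation so3_one_subproof.

Lemma so3_mulA : associative so3_mul.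
Proof. by move=> A B C; apply: so3_inj; exact: mulmxA. Qed.
Lemma so3_mul1 : left_id so3_one so3_mul.
Proof. by move=> A; apply: so3_inj; exact: mul1mx. Qed.
Lemma so3_mulr1 : right_id so3_one so3_mul.
Proof. by move=> A; apply: so3_inj; exact: mulmx1. Qed.
Lemma so3_mulV : left_inverse so3_one so3_inv so3_mul.
Proof. by move=> A; apply: so3_inj; exact: so3_orth. Qed.
Lemma so3_mulrV : right_inverse so3_one so3_inv so3_mul.
Proof. by move=> A; apply: so3_inj; exact: so3_orthC. Qed.

HB.instance Definition _ :=
  isGroup.Build SO3 so3_mulA so3_mul1 so3_mulr1 so3_mulV so3_mulrV.

End rotations.

Section double_cover.
Context (R : realType).

Definition imq (v : 'cV[R]_3) : quaternion R :=
  Quat 0 (v 0 0) (v 1 0) (v 2%:R 0).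

Definition qim (q : quaternion R) : 'cV[R]_3 :=
  \col_i [:: qi q; qj q; qk q]`_i.

(* The matrix of v |-> u v u^-1 on the imaginary quaternions R^3. *)
Definition su2_to_so3_mx (u : SU2 R) : 'M[R]_3 :=
  \matrix_(i, j) qim (qmul (qmul u (imq (delta_mx j 0))) (qconj u)) i 0.

Lemma sum3E (F : 'I_3 -> R) : \sum_i F i = F 0 + F 1 + F 2%:R.
Proof.
rewrite !big_ord_recl big_ord0 addr0 addrA.
by congr (F _ + F _ + F _); apply: val_inj.
Qed.

Lemma forall3 (P : 'I_3 -> Prop) : P 0 -> P 1 -> P 2%:R -> forall i, P i.
Proof.
move=> P0 P1 P2 [[|[|[|//]]] lti3].
- by rewrite (_ : Ordinal _ = 0)//; apply: val_inj.
- by rewrite (_ : Ordinal _ = 1)//; apply: val_inj.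
- by rewrite (_ : Ordinal _ = 2%:R)//; apply: val_inj.
Qed.

Lemma su2_to_so3_mxE (u : SU2 R) (v : 'cV[R]_3) :
  imq (su2_to_so3_mx u *m v) = qmul (qmul u (imq v)) (qconj u).
Proof.
case: u => [[a b c d] /= u1]; rewrite /imq /qmul /=.
by congr Quat; rewrite ?(mxE, sum3E)/= ?mxE/=; ring.
Qed.

Lemma det3E (A : 'M[R]_3) : \det A =
  A 0 0 * (A 1 1 * A 2%:R 2%:R - A 1 2%:R * A 2%:R 1)
  - A 0 1 * (A 1 0 * A 2%:R 2%:R - A 1 2%:R * A 2%:R 0)
  + A 0 2%:R * (A 1 0 * A 2%:R 1 - A 1 1 * A 2%:R 0).
Proof.
have [f fE] : exists f : nat -> nat -> R, forall i j, A i j = f i j.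
  exists (fun k l => A (inord k) (inord l)) => i j.
  by rewrite !inord_val.
rewrite (expand_det_row _ 0) sum3E /cofactor.
rewrite !(expand_det_row _ 0) !big_ord_recl !big_ord0 /cofactor !det_mx11 !mxE.
rewrite !fE /= /bump /= !(addn0, add0n).
rewrite (_ : (1 %% 3)%N = 1)// (_ : ((1 + 1) %% 3)%N = 2)//.
by rewrite -![(1 + 1)%N]/2%N /= ?(expr0, expr1) sqrrN expr1n; ring.
Qed.

Lemma su2_to_so3_mx_subproof (u : SU2 R) :
  (su2_to_so3_mx u)^T *m su2_to_so3_mx u = 1%:M /\ \det (su2_to_so3_mx u) = 1.
Proof.
case: u => [[a b c d] u1].
have u2 : (a ^+ 2 + b ^+ 2 + c ^+ 2 + d ^+ 2) ^+ 2 = 1.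
  by move: u1; rewrite /qnorm2/= => ->; rewrite expr1n.
have u3 : (a ^+ 2 + b ^+ 2 + c ^+ 2 + d ^+ 2) ^+ 3 = 1.
  by move: u1; rewrite /qnorm2/= => ->; rewrite expr1n.
split; last by rewrite det3E ?(mxE, sum3E)/= ?mxE/= -[RHS]u3; ring.
by apply/matrixP; apply: forall3; apply: forall3;
  rewrite ?(mxE, sum3E)/= ?mxE/= -?[RHS]u2; ring.
Qed.

Definition su2_to_so3 (u : SU2 R) : SO3 R := Rotation (su2_to_so3_mx_subproof u).

Lemma imq_inj : injective imq.
Proof. by move=> v w [e0 e1 e2]; apply/colP; exact: forall3. Qed.

Lemma qconjM (p q : quaternion R) :
  qconj (qmul p q) = qmul (qconj q) (qconj p).
Proof. by case: p q => [a b c d] [e f g h]; rewrite /qconj /qmul/=; congr Quat; ring. Qed.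

Lemma su2_to_so3M : {morph su2_to_so3 : u v / (u * v)%g}.
Proof.
move=> u v; apply: so3_inj; apply/trmx_inj/row_matrixP => i.
rewrite -!tr_col; congr trmx; rewrite !colE; apply: imq_inj.
by rewrite -[so3_val (_ * _)%g]/(su2_to_so3_mx u *m su2_to_so3_mx v) -mulmxA !su2_to_so3_mxE /=
  qconjM !qmulA.
Qed.

HB.instance Definition _ := isMultiplicative.Build (SU2 R) (SO3 R) su2_to_so3 su2_to_so3M.

End double_cover.

Section topology.
Context (R : realType).

(* The unit sphere S^n of Euclidean space R^(n+1). *)
Definition sphere (n : nat) : Type :=
  set_type [set v : 'rV[R]_n.+1 | \sum_i v 0 i ^+ 2 = 1].
HB.instance Definition _ (n : nat) := Topological.copy (sphere n)
  (set_type [set v : 'rV[R]_n.+1 | \sum_i v 0 i ^+ 2 = 1]).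

Definition open_embedding (X Y : topologicalType) (f : X -> Y) : Prop :=
  [/\ continuous f, injective f & forall A : set X, open A -> open (f @` A)].

Definition homeomorphism_onto (X Y : topologicalType) (f : X -> Y)
    (V : set X) (U : set Y) : Prop :=
  [/\ open V, set_bij V U f, {within V, continuous f} &
      forall A : set X, A `<=` V -> open A -> open (f @` A)].

(* Local coordinates (t, z) on S^3, with t in the line R and z in the plane
   R^2 = C, in which K is the line z = 0. *)
Definition flat_chart (K : set (sphere 3)) (psi : R * (R * R) -> sphere 3) :
    Prop :=
  open_embedding psi /\ forall t z, K (psi (t, z)) <-> z = (0, 0).

(* A knot is a locally flat embedded circle in S^3; local flatness is the
   topological form of tameness. *)
Definition is_knot (K : set (sphere 3)) : Prop :=
  (exists f : sphere 1 -> sphere 3,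
     [/\ continuous f, injective f & range f = K]) /\
  (forall y, K y -> exists psi, flat_chart K psi /\ psi (0, (0, 0)) = y).

Definition knot_complement (K : set (sphere 3)) : Type := set_type (~` K).
HB.instance Definition _ (K : set (sphere 3)) :=
  Topological.copy (knot_complement K) (set_type (~` K)).

(* Based at x0, a meridian follows a path delta to the unit circle around K in
   the plane t = 0 of a flat chart, goes once around it, and returns along
   delta.  It is well defined up to conjugation and inversion. *)
Definition is_meridian (K : set (sphere 3)) (x0 : knot_complement K)
    (m : pi1 R x0) : Prop :=
  exists psi, exists c : knot_complement K,
  exists delta : {path I01 R from x0 to c},
  exists mu : {path I01 R from c to c},
    [/\ flat_chart K psi,
        forall t : I01 R, \val (mu t) =
          psi (0, (cos (2 * pi * \val t), sin (2 * pi * \val t))) &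
        m = homotopy_class (concat (concat delta mu) (reverse delta))].

Section branched_cover.
Context (K : set (sphere 3)) (Sigma : topologicalType)
  (p : Sigma -> sphere 3).

Definition two_sheeted_at (y : sphere 3) : Prop :=
  exists U : set (sphere 3), exists V V' : set Sigma,
    [/\ open U /\ U y, V `&` V' = set0, V `|` V' = p @^-1` U,
        homeomorphism_onto p V U & homeomorphism_onto p V' U].

(* z |-> z ^+ 2 on C = R^2 *)
Definition complex_square (z : R * R) : R * R :=
  (z.1 ^+ 2 - z.2 ^+ 2, 2 * z.1 * z.2).

(* Over a flat chart at y, p reads (t, z) |-> (t, z ^+ 2). *)
Definition branched_at (y : sphere 3) : Prop :=
  exists psi : R * (R * R) -> sphere 3, exists psi' : R * (R * R) -> Sigma,
    [/\ flat_chart K psi /\ psi (0, (0, 0)) = y,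
        open_embedding psi', range psi' = p @^-1` (range psi) &
        forall t z, p (psi' (t, z)) = psi (t, complex_square z)].

(* For a knot K these conditions determine p : Sigma -> S^3 up to homeomorphism
   over S^3. *)
Definition double_branched_cover : Prop :=
  [/\ path_connected R Sigma, continuous p,
      forall y, ~ K y -> two_sheeted_at y & forall y, K y -> branched_at y].

End branched_cover.

End topology.

Section representations.
Context (R : realType).

Definition cyclic_image (G : groupType) (f : G -> SO3 R) : Prop :=
  exists g : SO3 R,
    range f = [set h | exists n, h = (g ^+ n)%g \/ h = (g ^- n)%g].

(* Elements of SO(3) are isometries, so those preserving the plane P act on it
   by elements of O(2), i.e. by rotations and reflections. *)
Definition dihedral_subgroup (P : {vspace 'cV[R]_3}) : set (SO3 R) :=
  [set A : SO3 R | forall v, v \in P -> A *m v \in P].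

Definition dihedral (G : groupType) (f : G -> SO3 R) : Prop :=
  exists P : {vspace 'cV[R]_3},
    (\dim P = 2)%N /\ range f `<=` dihedral_subgroup P.

Definition binary_dihedral (G : groupType) (rho : G -> SU2 R) : Prop :=
  dihedral (@su2_to_so3 R \o rho).

(* R(K; i) *)
Definition traceless_reps (K : set (sphere R 3)) (x0 : knot_complement K)
    (m : pi1 R x0) : set {multiplicative pi1 R x0 -> SU2 R} :=
  [set rho : {multiplicative pi1 R x0 -> SU2 R} |
    exists u : SU2 R, rho m = (su2_i R ^ u)%g].

Definition SU2_simple (K : set (sphere R 3)) : Prop :=
  forall (x0 : knot_complement K) (m : pi1 R x0), is_meridian m ->
  forall rho, traceless_reps m rho -> binary_dihedral rho.

End representations.

(* Main.v *)
(* Composing a traceless representation with SU(2) -> SO(3) gives a homomorphism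
   on pi_1(S^3 - K) sending the meridian to a rotation of order at most two.
   Read it as a locally constant system on S^3 - K.  Its monodromy around K has
   order at most two near one point of K, hence near all of them since K is
   connected; pulled back to Sigma, where the local model is z |-> z^2, the
   monodromy around the branch set becomes trivial and the system extends over
   Sigma.  The holonomy of the extension is a homomorphism from pi_1(Sigma) to
   SO(3), so its image is cyclic and fixes an axis.  The loops of S^3 - K that
   lift to loops of Sigma form a subgroup of index at most two, whose image
   fixes an axis; by normality the whole image preserves an axis, hence the
   plane orthogonal to it. *)

Require Import Defs.
From HB Require Import structures.
From mathcomp Require Import all_boot all_order all_algebra.
From mathcomp Require Import all_classical all_reals all_analysis homotopy.
From mathcomp Require Import ring lra.

Set Implicit Arguments.
Unset Strict Implicit.
Unset Printing Implicit Defensive.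

Import Order.TTheory GRing.Theory Num.Theory numFieldNormedType.Exports.

Local Open Scope classical_set_scope.
Local Open Scope ring_scope.

(** * Local cocycles and flat functions *)

(** The system is encoded by a group-valued function [c s t] on pairs of nearby points, and its
    parallel sections by the functions satisfying [flat_at]; no covering space is built. This form
    is what makes the extension over the branch set possible, where the system has no value to start
    from: there [c s t] is defined as the constant relating two flat functions at points off the
    branch set. Three facts are needed: such functions exist (squaring kills a monodromy of order at
    most two), they are rigid (a small ball minus the axis is connected), and the complement of the
    branch set is dense. The order of the monodromy must pass between flat charts that overlap in no
    controlled way, so it is restated without charts, as [square_trivial], a condition on all small
    loops near a point of the knot. The final axis argument has a degenerate case: when the loops
    that lift act trivially, their axis says nothing about the other loops, and the axis of one of
    the remaining rotations is used instead. *)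

Lemma near_continuous (X Y : topologicalType) (f : X -> Y) (x : X)
    (P : Y -> Prop) : {for x, continuous f} -> (\forall y \near f x, P y) ->
  \forall x' \near x, P (f x').
Proof. by move=> fx; exact: fx. Qed.

(** A supremum argument standing in for Lebesgue numbers: the local hypothesis at the supremum of
    the reachable points pushes past it unless it is [b]. Every later subdivision of an interval is
    an instance. *)
Lemma interval_induction (R : realType) (P : R -> R -> Prop) (a b : R) :
  a <= b ->
  (forall x y z, a <= x -> x <= y -> y <= z -> z <= b ->
     P x y -> P y z -> P x z) ->
  (forall s, a <= s <= b -> exists2 N, nbhs s N & forall x y, N x -> N y ->
     x <= s -> s <= y -> a <= x -> y <= b -> P x y) ->
  P a b.
Proof.
move=> ab Padd Ploc.
pose S : set R := [set t | a <= t <= b /\ P a t].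
have Sa : S a.
  split; first by rewrite lexx ab.
  have [|N Na] := Ploc a; first by rewrite lexx ab.
  by apply => //; exact: nbhs_singleton.
have hS : has_sup S by split; [exists a|exists b => t [/andP[]]].
have aS : a <= sup S by exact: sup_upper_bound.
have Sb : sup S <= b by apply: sup_le_ub => [|t [/andP[]]]; [exists a|].
have [|N /nbhs_ballP[e /= e0 eN] PN] := Ploc (sup S); first by rewrite aS Sb.
have [t St te] := sup_adherent e0 hS.
have tS : t <= sup S by exact: sup_upper_bound.
have [[/andP[at_ tb] Pat]] := St.
have PaS y : sup S <= y -> y <= b -> y < sup S + e -> P a y.
  move=> Sy yb ye; apply: (Padd _ t) => //; first exact: le_trans Sy.
  apply: PN => //; apply: eN; rewrite /ball /= ltr_norml; lra.
have [bS|bS] := leP b (sup S).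
  by apply: PaS; lra.
pose y := Num.min b (sup S + e / 2).
have Sy : sup S < y by rewrite lt_min bS/=; lra.
suff /(sup_upper_bound hS) : S y by lra.
split; first by rewrite (le_trans aS (ltW Sy))/= ge_min lexx.
by apply: PaS; [exact: ltW|rewrite ge_min lexx|rewrite gt_min; apply/orP; right; lra].
Qed.

Lemma locally_constant_segment (R : realType) (G : Type) (k : R -> G) (a b : R) :
  a <= b -> (forall s, a <= s <= b -> \forall t \near s, k t = k s) ->
  k a = k b.
Proof.
move=> ab lk; apply: (@interval_induction R (fun x y => k x = k y)) => //.
- by move=> x y z _ _ _ _ ->.
- by move=> s /lk ks; exists (fun t => k t = k s) => // x y -> ->.
Qed.

Section local_cocycles.
Context (T : topologicalType) (G : groupType) (c : T -> T -> G).

(* The transition functions of a locally constant system: c s t compares a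
   local trivialisation at s with one at t, for t close to s. *)
Definition local_cocycle : Prop := forall s, \forall t \near s,
  \forall t' \near t, c s t' = (c s t * c t t')%g.

(** A parallel section along [F], as a germ at [z]. The cocycle acts on the right, so left factors
    that are locally constant preserve flatness. *)
Definition flat_at (Z : topologicalType) (F : Z -> T) (u : Z -> G) (z : Z) :
    Prop :=
  \forall z' \near z, u z' = (u z * c (F z) (F z'))%g.

Hypothesis cP : local_cocycle.

(** Taken at [t = t' = s], the cocycle rule makes [c s s] idempotent. *)
Lemma local_cocycle1 s : c s s = 1%g.
Proof.
have /nbhs_singleton/nbhs_singleton e := cP s.
by apply: (@mulgI _ (c s s)); rewrite -e mulg1.
Qed.

Section flat_sections.
Context (Z : topologicalType).
Implicit Types (F : Z -> T) (u v k : Z -> G).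

(** The basic source of flat functions, a rereading of the cocycle rule. Continuity at [z] stays a
    premise because some maps [F] used later are continuous only off an axis or a branch set. *)
Lemma flat_locally F z0 : {for z0, continuous F} ->
  \forall z \near z0, {for z, continuous F} ->
    flat_at F (fun z' => c (F z0) (F z')) z.
Proof.
move=> F0; have := near_continuous F0 (cP (F z0)); apply: filterS => z N Fz.
exact: (near_continuous Fz N).
Qed.

(** The right factors cancel. This is the rigidity on which all later comparisons rest. *)
Lemma flat_quotient F u v z : flat_at F u z -> flat_at F v z ->
  \forall z' \near z, (u z' * (v z')^-1 = u z * (v z)^-1)%g.
Proof.
by apply: filterS2 => z' -> ->; rewrite invgM mulgA mulgK.
Qed.

Lemma flat_mull F u k z : flat_at F u z ->
  (\forall z' \near z, k z' = k z) -> flat_at F (fun z => k z * u z)%g z.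
Proof.
by apply: filterS2 => z' -> ->; rewrite mulgA.
Qed.

Lemma flat_mull_cst F u (k : G) z : flat_at F u z ->
  flat_at F (fun z => k * u z)%g z.
Proof. by move=> /(@flat_mull F u (fun=> k)); apply; exact: filterE. Qed.

Lemma flat_near F F' u u' z : (\forall z' \near z, F z' = F' z') ->
  (\forall z' \near z, u z' = u' z') -> flat_at F u z -> flat_at F' u' z.
Proof.
move=> FF' uu'; rewrite /flat_at -(nbhs_singleton FF') -(nbhs_singleton uu').
by move: FF' uu'; apply: filterS3 => z' <- <-.
Qed.

End flat_sections.

Lemma flat_comp (Y Z : topologicalType) (g : Y -> Z) (F : Z -> T) u y :
  {for y, continuous g} -> flat_at F u (g y) -> flat_at (F \o g) (u \o g) y.
Proof. by move=> gy uy; exact: (near_continuous gy uy). Qed.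

Section contractible.
Context (R : realType).

Lemma flat_unique (F : R -> T) (u v : R -> G) (a b : R) : a <= b ->
  (forall s, a <= s <= b -> flat_at F u s) ->
  (forall s, a <= s <= b -> flat_at F v s) ->
  (u a * (v a)^-1 = u b * (v b)^-1)%g.
Proof.
move=> ab fu fv; apply: (@locally_constant_segment R G
  (fun s => u s * (v s)^-1)%g) => // s sab.
by apply: flat_quotient; [exact: fu|exact: fv].
Qed.

Context (Z : topologicalType) (F : R * Z -> T) (A : set Z) (x : T).
Hypotheses (oA : open A) (F0 : forall z, A z -> F (0, z) = x).
Hypothesis (cF : forall s z, 0 <= s <= 1 -> A z -> {for (s, z), continuous F}).

Let slice_continuous (s : R) (z : Z) : {for z, continuous (fun z' => (s, z'))}.
Proof. by apply: (@continuous_pair Z) => z'; [exact: cvg_cst|exact: cvg_id]. Qed.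

(** Only the first coordinate is subdivided; the neighbourhood of [z] shrinks at each gluing. *)
Lemma flat_strip z : A z -> exists u, \forall z' \near z,
  forall s, 0 <= s <= 1 -> flat_at F u (s, z').
Proof.
move=> Az; pose P (a b : R) := exists u, \forall z' \near z,
  forall s, a <= s <= b -> flat_at F u (s, z').
apply: (@interval_induction R P).
- exact: ler01.
- move=> a m b a0 am mb b1 [u fu] [v fv].
  (* The mismatch of the two pieces at height [m] is locally constant in [z'], so its value at [z]
     corrects [v] over a whole neighbourhood. *)
  pose k z' := (u (m, z') * (v (m, z'))^-1)%g.
  have kz : \forall z' \near z, k z' = k z.
    apply: (near_continuous (P := fun p => (u p * (v p)^-1 = k z)%g)
      (@slice_continuous m z)); apply: flat_quotient.
      by apply: (nbhs_singleton fu); rewrite am lexx.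
    by apply: (nbhs_singleton fv); rewrite mb lexx.
  exists (fun p => if p.1 <= m then u p else k z * v p)%g.
  near=> z' => s /andP[as_ sb].
  have fu' : forall s, a <= s <= m -> flat_at F u (s, z') by near: z'.
  have fv' : forall s, m <= s <= b -> flat_at F v (s, z') by near: z'.
  have kz' : k z' = k z by near: z'.
  have [sm|sm|sm] := ltgtP s m.
  + apply: flat_near (fu' s _); last by rewrite as_ ltW.
      exact: filterE.
    have : \forall p \near (s, z'), p.1 < m.
      exact: (@cvg_fst _ _ (nbhs s) (nbhs z') _ _ (lt_nbhsl sm)).
    by apply: filterS => p /ltW ->.
  + apply: flat_near (flat_mull_cst (k z) (fv' s _)); last by rewrite sb ltW.
      exact: filterE.
    have : \forall p \near (s, z'), m < p.1.
      exact: (@cvg_fst _ _ (nbhs s) (nbhs z') _ _ (lt_nbhsr sm)).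
    by apply: filterS => p; rewrite leNgt => ->.
  + rewrite {}sm in as_ sb *; rewrite /flat_at/= lexx.
    have u1 : flat_at F u (m, z') by apply: fu'; rewrite am lexx.
    have v1 : flat_at F v (m, z') by apply: fv'; rewrite mb lexx.
    near=> p.
    case: ifP => _; first by near: p; exact: u1.
    have -> : v p = (v (m, z') * c (F (m, z')) (F p))%g by near: p; exact: v1.
    by rewrite mulgA -kz' /k mulgVK.
- move=> s s01; have sz := cF s01 Az.
  have [[N1 N2] /= [/nbhs_ballP[e /= e0 eN1] zN2] N12] := flat_locally sz.
  exists (ball s e); first exact: nbhsx_ballx.
  move=> a b ae be as_ sb a0 b1; exists (fun p => c (F (s, z)) (F p)).
  near=> z' => t /andP[at_ tb]; apply: (N12 (t, z')).
    split=> /=; last by near: z'.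
    move: ae be; rewrite /ball/= !ltr_norml => ae be; apply: eN1.
    rewrite /ball/= ltr_norml; lra.
  by apply: cF; [lra|near: z'; exact: open_nbhs_nbhs].
Unshelve. all: by end_near. Qed.

(** Since [F] is constant at time 0, each strip can be normalised to 1 there. Two normalised strips
    over the same [z'] then agree at time 1 by uniqueness along the segment, so the local choices
    [u z] fit together. *)
Lemma flat_contractible :
  exists w, forall z, A z -> flat_at (fun z' => F (1, z')) w z.
Proof.
have /choice[u hu] : forall z, exists u : R * Z -> G, A z -> \forall z' \near z,
    [/\ A z', forall s, 0 <= s <= 1 -> flat_at F u (s, z') & u (0, z') = 1%g].
  move=> z; have [Az|nAz] := pselect (A z); last by exists (fun=> 1%g).
  have [u fu] := flat_strip Az.
  exists (fun p => (u (0, z))^-1 * u p)%g => _.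
  have u0 : \forall z' \near z, u (0, z') = (u (0, z) * c (F (0, z)) (F (0, z')))%g.
    apply: (near_continuous
      (P := fun p => u p = (u (0, z) * c (F (0, z)) (F p))%g)
      (@slice_continuous 0 z)).
    by apply: (nbhs_singleton fu); rewrite lexx ler01.
  near=> z'.
  have Az' : A z' by near: z'; exact: open_nbhs_nbhs.
  have fuz' : forall s, 0 <= s <= 1 -> flat_at F u (s, z') by near: z'.
  split=> // [s s01|]; first by apply: flat_mull_cst; exact: fuz'.
  have -> : u (0, z') = (u (0, z) * c (F (0, z)) (F (0, z')))%g by near: z'.
  by rewrite !F0// local_cocycle1 mulg1 mulVg.
exists (fun z => u z (1, z)) => z Az.
have [_ fz u1] := nbhs_singleton (hu _ Az).
have e1 : \forall z' \near z,
    u z (1, z') = (u z (1%R, z) * c (F (1%R, z)) (F (1%R, z')))%g.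
  apply: (near_continuous
    (P := fun p => u z p = (u z (1%R, z) * c (F (1%R, z)) (F p))%g)
    (@slice_continuous 1 z)).
  by apply: fz; rewrite lexx ler01.
rewrite /flat_at; near=> z'.
have [Az' fz' u1'] : [/\ A z', forall s, 0 <= s <= 1 -> flat_at F (u z) (s, z') &
    u z (0, z') = 1%g] by near: z'; exact: hu.
have [_ fz'' u1''] := nbhs_singleton (hu _ Az').
have line v : (forall s, 0 <= s <= 1 -> flat_at F v (s, z')) ->
    forall s, 0 <= s <= 1 -> flat_at (fun s => F (s, z')) (fun s => v (s, z')) s.
  move=> fv s /fv fvs; apply: (@flat_comp _ _ (fun s => (s, z')) F v) => //.
  by apply: (@continuous_pair R) => s'; [exact: cvg_id|exact: cvg_cst].
have := flat_unique (@ler01 R) (line _ fz') (line _ fz'').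
rewrite u1' u1'' mulgV => /esym/divg1_eq <-.
by near: z'.
Unshelve. all: by end_near. Qed.

End contractible.

Section flat_star.
Context (R : realType) (V : normedModType R).

(** [H] composed with the radial contraction [kap] is constant at time 0 and equals [H] at time
    1. *)
Lemma flat_star (H : V -> T) (A : set V) (v0 : V) : open A ->
  (forall v s, A v -> 0 <= s <= 1 -> A (v0 + s *: (v - v0))) ->
  (forall v, A v -> {for v, continuous H}) ->
  exists w, forall v, A v -> flat_at H w v.
Proof.
move=> oA stA cH.
pose kap (p : R * V) := v0 + p.1 *: (p.2 - v0).
have ckap : continuous kap.
  move=> p; apply: cvgD; first exact: cvg_cst.
  by apply: cvgZ; [exact: cvg_fst|apply: cvgB; [exact: cvg_snd|exact: cvg_cst]].
have [||w fw] := @flat_contractible R V (H \o kap) A (H v0) oA.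
- by move=> z _; rewrite /kap /= scale0r addr0.
- move=> s z s01 Az; apply: continuous_comp; first exact: ckap.
  by apply: cH; exact: stA.
exists w => v /fw; apply: flat_near; last exact: filterE.
by apply: filterE => z; rewrite /kap/= scale1r subrKC.
Qed.

Lemma flat_total (H : V -> T) : continuous H ->
  exists w, forall v, flat_at H w v.
Proof.
move=> cH; have [||w fw] := @flat_star H setT 0 openT.
- by [].
- by move=> v _; exact: cH.
- by exists w => v; exact: fw.
Qed.

End flat_star.
End local_cocycles.

(** * Holonomy *)

Section holonomy.
Context (R : realType) (T : topologicalType) (G : groupType) (c : T -> T -> G).
Hypothesis cP : local_cocycle c.
Implicit Types (g : R -> T) (w : R -> G).

Definition flat_lift g : R -> G :=
  if pselect (exists w, forall t, flat_at c g w t) is left h then sval (cid h)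
  else fun=> 1%g.

Definition transport g : G := ((flat_lift g 0%R)^-1 * flat_lift g 1%R)%g.

Lemma flat_liftP g : continuous g -> forall t, flat_at c g (flat_lift g) t.
Proof.
move=> cg; rewrite /flat_lift; case: pselect => [h|[]]; first by case: cid.
exact: (flat_total cP cg).
Qed.

Lemma transportE g w : continuous g ->
  (forall t, 0 <= t <= 1 -> flat_at c g w t) ->
  transport g = ((w 0%R)^-1 * w 1%R)%g.
Proof.
move=> /flat_liftP fg fw; rewrite /transport.
have /(congr1 (fun x => x * w 0%R)%g) := flat_unique (@ler01 R) (fun s _ => fg s) fw.
by rewrite mulgVK => ->; rewrite invgM invgM invgK !mulgA mulgVK.
Qed.

Lemma transport_cst g x : (forall t, g t = x) -> transport g = 1%g.
Proof.
move=> gx; rewrite (_ : g = fun=> x); last exact/funext.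
rewrite (@transportE _ (fun=> 1%g)); first by rewrite mulVg.
  by move=> t; exact: cvg_cst.
by move=> t _; apply: filterE => t'; rewrite local_cocycle1// mulg1.
Qed.

(** One flat function on the whole plane computes both transports; it takes equal values at the two
    ends of each vertical side, because transport along a constant map is trivial. *)
Lemma transport_square (H : R * R -> T) x y : continuous H ->
  (forall s, H (0, s) = x) -> (forall s, H (1, s) = y) ->
  transport (fun t => H (t, 0)) = transport (fun t => H (t, 1)).
Proof.
move=> cH Hx Hy; have [w fw] : exists w : R * R -> G, forall p, flat_at c H w p
  by exact: (flat_total cP cH).
have cl (a : R) : continuous (fun t : R => (t, a)).
  by apply: continuous_pair => t; [exact: cvg_id|exact: cvg_cst].
have cr (a : R) : continuous (fun t : R => (a, t)).
  by apply: continuous_pair => t; [exact: cvg_cst|exact: cvg_id].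
have row (a : R) : transport (fun t => H (t, a)) = ((w (0%R, a))^-1 * w (1%R, a))%g.
  apply: (@transportE _ (fun t => w (t, a))) => [|t _].
    by move=> t; apply: continuous_comp; [exact: cl|exact: cH].
  by apply: (@flat_comp _ _ _ _ _ (fun t => (t, a)) H w); [exact: cl|exact: fw].
have col (a : R) z : (forall s, H (a, s) = z) -> w (a, 0) = w (a, 1).
  move=> Haz; have := transport_cst Haz.
  rewrite (@transportE _ (fun t => w (a, t))) => [/mulg1_eq|t|t _].
  - by rewrite invgK.
  - by apply: continuous_comp; [exact: cr|exact: cH].
  - by apply: (@flat_comp _ _ _ _ _ (fun t => (a, t)) H w); [exact: cr|exact: fw].
by rewrite !row (col _ _ Hx) (col _ _ Hy).
Qed.

Lemma transport_homotopic x y (f h : {path I01 R from x to y}) :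
  path_homotopic f h -> transport (pathR f) = transport (pathR h).
Proof.
move=> [K [cK K0 K1 Kx Ky]].
pose H (p : R * R) := K (toI p.1, toI p.2).
have -> : pathR f = fun t => H (t, 0).
  by apply/funext => t; rewrite /H/= [toI 0]toI_le0// K0.
have -> : pathR h = fun t => H (t, 1).
  by apply/funext => t; rewrite /H/= [toI 1]toI_ge1// K1.
apply: (@transport_square H x y) => [p|s|s].
- apply: continuous_comp; last exact: cK.
  apply: (@continuous_pair (R * R)%type) => {}p; apply: continuous_comp.
  + exact: cvg_fst.
  + exact: toI_continuous.
  + exact: cvg_snd.
  + exact: toI_continuous.
- by rewrite /H/= [toI 0]toI_le0// Kx.
- by rewrite /H/= [toI 1]toI_ge1// Ky.
Qed.

Lemma transport_concat x y z (f : {path I01 R from x to y})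
    (h : {path I01 R from y to z}) :
  transport (pathR (concat f h)) = (transport (pathR f) * transport (pathR h))%g.
Proof.
have [u fu] : exists u : R -> G, forall t, flat_at c (pathR f) u t.
  exact: (flat_total cP (@pathR_continuous _ _ _ _ f)).
have [v fv] : exists v : R -> G, forall t, flat_at c (pathR h) v t.
  exact: (flat_total cP (@pathR_continuous _ _ _ _ h)).
rewrite (transportE (@pathR_continuous _ _ _ _ f) (fun t _ => fu t)).
rewrite (transportE (@pathR_continuous _ _ _ _ h) (fun t _ => fv t)).
(* The factor that makes the two pieces of [w] agree at the junction. *)
pose k := (u 1%R * (v 0%R)^-1)%g.
pose w t := if t <= 2^-1 then u (2 * t) else (k * v (2 * t - 1)%R)%g.
rewrite (@transportE _ w (@pathR_continuous _ _ _ _ (concat f h))); last first.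
  move=> t _.
  have fu' : flat_at c (pathR f \o (fun t => 2 * t)) (u \o (fun t => 2 * t)) t.
    apply: flat_comp => //.
    by apply: continuous_mulR => t'; [exact: cvg_cst|exact: cvg_id].
  have fv' : flat_at c (pathR h \o (fun t => 2 * t - 1))
      (fun s => k * (v \o (fun t => 2 * t - 1)%R) s)%g t.
    apply: flat_mull_cst; apply: flat_comp => //.
    apply: continuous_subR => t'; last exact: cvg_cst.
    by apply: continuous_mulR => {}t'; [exact: cvg_cst|exact: cvg_id].
  have [t2|t2|t2] := ltgtP t 2^-1.
  + have lt2 : \forall s \near t, s <= 2^-1.
      by have := lt_nbhsl t2; apply: filterS => s /ltW.
    apply: flat_near fu'; move: lt2; apply: filterS => s s2.
      by rewrite [RHS]pathR_concat s2.
    by rewrite /w s2.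
  + have lt2 : \forall s \near t, (s <= 2^-1) = false.
      by have := lt_nbhsr t2; apply: filterS => s; rewrite leNgt => ->.
    apply: flat_near fv'; move: lt2; apply: filterS => s s2.
      by rewrite [RHS]pathR_concat s2.
    by rewrite /w s2.
  + move: fu' fv'; rewrite t2 /flat_at; apply: filterS2 => s.
    rewrite /comp mulfV ?subrr// !pathR_concat /w lexx mulfV//.
    rewrite pathR_ge1// [pathR h 0]pathR_le0//.
    case: (s <= 2^-1) => us vs; rewrite ?us ?vs//.
    by rewrite /k mulgVK.
rewrite /w ifT; last by lra.
rewrite ifF; last by lra.
have e21 : 2 * 1 - 1 = 1 :> R by lra.
by rewrite mulr0 e21 /k !mulgA.
Qed.

Lemma transport_reverse x y (f : {path I01 R from x to y}) :
  transport (pathR (reverse f)) = (transport (pathR f))^-1%g.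
Proof.
apply/esym/mulg1_eq; rewrite -transport_concat.
rewrite (transport_homotopic (concat_reverser f)).
exact: (@transport_cst _ x).
Qed.

Definition pi1_holonomy (b : T) (a : pi1 R b) : G := transport (pathR (repr a)).

Lemma pi1_holonomyE b (f : {path I01 R from b to b}) :
  pi1_holonomy (homotopy_class f) = transport (pathR f).
Proof.
by apply: transport_homotopic; apply/homotopy_classP; exact: homotopy_class_repr.
Qed.

Lemma pi1_holonomyM b : {morph @pi1_holonomy b : x y / (x * y)%g}.
Proof.
elim/pi1_ind => f; elim/pi1_ind => h.
by rewrite homotopy_classM !pi1_holonomyE transport_concat.
Qed.

End holonomy.

(** * Representations of the fundamental group as local cocycles *)

Section multiplicative.
Context (G H : groupType) (f : {multiplicative G -> H}).

Lemma multiplicative1 : f 1%g = 1%g.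
Proof. by apply: (@mulgI _ (f 1%g)); rewrite -gmulfM !mulg1. Qed.

Lemma multiplicativeV x : f x^-1%g = (f x)^-1%g.
Proof. by apply/esym/mulg1_eq; rewrite -gmulfM mulgV multiplicative1. Qed.

End multiplicative.

Section path_transport.
Context (R : realType) (X : topologicalType).

Definition path_in (W : set X) x y (f : {path I01 R from x to y}) : Prop :=
  forall t, W (f t).

Lemma path_in_concat W x y z (f : {path I01 R from x to y})
    (g : {path I01 R from y to z}) :
  path_in W f -> path_in W g -> path_in W (concat f g).
Proof.
move=> Wf Wg t; rewrite -pathR_val pathR_concat.
by case: ifP => _; [exact: Wf|exact: Wg].
Qed.

Definition locally_path_connected : Prop := forall (x : X) (W : set X),
  nbhs x W -> exists2 W', nbhs x W' & forall y z, W' y -> W' z ->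
    exists f : {path I01 R from y to z}, path_in W f.

(** The homotopy may leave [W]. Two paths with common ends replace the usual loop contractible in
    [X]. *)
Definition semilocally_simply_connected : Prop := forall x : X,
  exists2 W, nbhs x W & forall y z (f g : {path I01 R from y to z}),
    path_in W f -> path_in W g -> path_homotopic f g.

Section subpath.
Context (x y : X) (f : {path I01 R from x to y}) (a b : R).

Definition subpath_fun (t : I01 R) : X := pathR f (a + \val t * (b - a)).

Lemma subpath_continuous : continuous subpath_fun.
Proof.
apply: continuous_compR; last exact: pathR_continuous.
apply: continuous_addR; first exact: continuous_cstR.
by apply: continuous_mulR; [exact: val_continuous|exact: continuous_cstR].
Qed.

Lemma subpath_zero : subpath_fun zero = pathR f a.
Proof. by rewrite /subpath_fun val_zero mul0r addr0. Qed.

Lemma subpath_one : subpath_fun one = pathR f b.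
Proof. by rewrite /subpath_fun val_one mul1r subrKC. Qed.

Definition subpath : {path I01 R from pathR f a to pathR f b} :=
  mk_path subpath_continuous subpath_zero subpath_one.

Lemma pathR_subpath t : 0 <= t <= 1 ->
  pathR subpath t = pathR f (a + t * (b - a)).
Proof. by move=> t01; rewrite {1}/pathR /= /mk_path /subpath_fun clampK. Qed.

End subpath.

(** Both sides reparametrise [f] extended to the line, so [a], [b], [c] may come in any order. *)
Lemma subpath_concat x y (f : {path I01 R from x to y}) a b c :
  path_homotopic (concat (subpath f a b) (subpath f b c)) (subpath f a c).
Proof.
apply: (@reparam_homotopic _ _ _ _ _ _ f _ _
  (fun t => a + (b - a) * Num.min (2 * t + 0) 1
              + (c - b) * Num.max 0 (2 * t + - 1))
  (fun t => a + t * (c - a))).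
- apply: continuous_addR; first apply: continuous_addR.
  + exact: continuous_cstR.
  + apply: continuous_mulR; first exact: continuous_cstR.
    by apply: continuous_minR; [exact: affine_continuous|exact: continuous_cstR].
  + apply: continuous_mulR; first exact: continuous_cstR.
    by apply: continuous_maxR; [exact: continuous_cstR|exact: affine_continuous].
- apply: continuous_addR; first exact: continuous_cstR.
  apply: continuous_mulR; last exact: continuous_cstR.
  by move=> t; exact: cvg_id.
- by rewrite min_l ?max_l; lra.
- by rewrite min_r ?max_r; lra.
- move=> t; have t01 := I01P t.
  rewrite -pathR_val pathR_concat; set s := \val t in t01 *.
  have [s2|s2] := leP s 2^-1.
    rewrite pathR_subpath ?min_l ?max_l; [|lra..].
    by congr pathR; lra.
  rewrite pathR_subpath ?min_r ?max_r; [|lra..].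
  by congr pathR; lra.
- by [].
Qed.

Hypotheses (lpc : locally_path_connected) (slsc : semilocally_simply_connected).
Context (G : groupType)
  (Phi : forall x y : X, {path I01 R from x to y} -> G).
Hypothesis PhiM : forall x y z (f : {path I01 R from x to y})
  (g : {path I01 R from y to z}), Phi (concat f g) = (Phi f * Phi g)%g.
Hypothesis Phi_homotopic : forall x y (f g : {path I01 R from x to y}),
  path_homotopic f g -> Phi f = Phi g.

(** The ends of subpaths are only propositionally the expected points, hence this comparison across
    different types of paths. *)
Lemma Phi_ext x y x' y' (f : {path I01 R from x to y})
    (g : {path I01 R from x' to y'}) : f =1 g -> Phi f = Phi g.
Proof.
move=> fg; have xx : x = x' by rewrite -(@path_zero _ _ _ _ f) fg path_zero.
have yy : y = y' by rewrite -(@path_one _ _ _ _ f) fg path_one.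
by subst x' y'; congr Phi; apply/path_eqP.
Qed.

(** [e x y] is [Phi] of any path from [x] to [y] inside a neighbourhood [W x] where such paths are
    homotopic. As [W] varies with its base point, the cocycle rule asks [t'] to be close to [t]: the
    second path must stay in both [W s] and [W t]. *)
Lemma path_transport_cocycle : exists2 e, local_cocycle e &
  forall x y (f : {path I01 R from x to y}), transport e (pathR f) = Phi f.
Proof.
have /choice[W hW] : forall x : X, exists W : set X, nbhs x W /\
    forall y z (f g : {path I01 R from y to z}),
    path_in W f -> path_in W g -> path_homotopic f g.
  by move=> x; have [W xW hW] := slsc x; exists W.
pose e x y := if pselect (exists f : {path I01 R from x to y}, path_in (W x) f)
  is left h then Phi (sval (cid h)) else 1%g.
have eE x y (f : {path I01 R from x to y}) : path_in (W x) f -> e x y = Phi f.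
  move=> Wf; rewrite /e; case: pselect => [h|[]]; last by exists f.
  by case: cid => g Wg /=; apply: Phi_homotopic; apply: (hW x).2.
have eP : local_cocycle e.
  move=> s; have [W1 sW1 W1P] := lpc (hW s).1.
  have W1s := nbhs_singleton sW1.
  near=> t.
  have W1t : W1 t by near: t.
  have tW : nbhs t (W s) by near: t; exact: nbhs_interior (hW s).1.
  have [W2 tW2 W2P] := lpc (filterI tW (hW t).1).
  have W2t := nbhs_singleton tW2.
  apply: filterS tW2 => t' W2t'.
  have [f Wf] := W1P _ _ W1s W1t.
  have [g Wg] := W2P _ _ W2t W2t'.
  rewrite (eE _ _ f)// (eE _ _ g) => [|r]; last by have [] := Wg r.
  rewrite -PhiM; apply: eE; apply: path_in_concat => // r.
  by have [] := Wg r.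
exists e => // x y f.
have cf := @pathR_continuous _ _ _ _ f.
have [w fw] : exists w : R -> G, forall t, flat_at e (pathR f) w t.
  exact: (flat_total eP cf).
rewrite (transportE eP cf (fun t _ => fw t)).
rewrite -(@Phi_ext _ _ _ _ (subpath f 0 1)); last first.
  by move=> t /=; rewrite /mk_path /subpath_fun subr0 mulr1 add0r pathR_val.
apply/esym.
apply: (@interval_induction R (fun a b => Phi (subpath f a b) = ((w a)^-1 * w b)%g)).
- exact: ler01.
- move=> a b c _ _ _ _ ab bc.
  by rewrite -(Phi_homotopic (subpath_concat f a b c)) PhiM ab bc mulgA mulgK.
- move=> s _; have [W1 sW1 W1P] := lpc (hW (pathR f s)).1.
  have : \forall t \near s, [/\ W1 (pathR f t), W (pathR f s) (pathR f t) &
      w t = (w s * e (pathR f s) (pathR f t))%g].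
    have n1 := near_continuous (cf s) sW1.
    have n2 := near_continuous (cf s) (hW (pathR f s)).1.
    by move: n1 n2 (fw s); apply: filterS3.
  move=> /nbhs_ballP[r /= r0 rP].
  exists (ball s r); first exact: nbhsx_ballx.
  move=> a b ra rb as_ sb _ _.
  have [Wa _ wa] := rP _ ra; have [Wb _ wb] := rP _ rb.
  (* [g] joins [f s] to [f a]. Followed by the subpath it computes [e] at [f b], so that [Phi g]
     cancels in the quotient. *)
  have [g Wg] := W1P _ _ (nbhs_singleton sW1) Wa.
  have Wsub : path_in (W (pathR f s)) (subpath f a b).
    move=> t; have := I01P t.
    suff: 0 <= \val t <= 1 -> ball s r (a + \val t * (b - a)).
      by move=> + t01 => /(_ t01) /rP[].
    move: (\val t) => v /andP[v0 v1].
    move: ra rb; rewrite /ball/= !ltr_norml => ra rb.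
    have /andP[m0 m1] : 0 <= v * (b - a) <= b - a.
      by rewrite mulr_ge0 ?ler_piMl//; lra.
    by apply/andP; lra.
  rewrite wa wb (eE _ _ g)// (eE _ _ (concat g (subpath f a b))); last first.
    exact: path_in_concat.
  by rewrite PhiM invgM !mulgA mulgVK mulVg mul1g.
Unshelve. all: by end_near. Qed.

End path_transport.
Section groupoid_extension.
Context (R : realType) (X : topologicalType) (x0 : X) (G : groupType)
  (alpha : {multiplicative pi1 R x0 -> G}).

(** A chosen path from [x0], or [None] outside the path component of [x0], where [Phi] is set to
    1. *)
Let base (x : X) : option {path I01 R from x0 to x} :=
  if pselect (exists _ : {path I01 R from x0 to x}, True) is left h
  then Some (sval (cid h)) else None.

Let base_path x : {path I01 R from x0 to x} -> exists p, base x = Some p.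
Proof.
move=> f; rewrite /base; case: pselect => [h|[]]; last by exists f.
by exists (sval (cid h)).
Qed.

Let Phi x y (f : {path I01 R from x to y}) : G :=
  match base x, base y with
  | Some p, Some q => alpha (homotopy_class (concat (concat p f) (reverse q)))
  | _, _ => 1%g
  end.

Let Phi_homotopic x y (f g : {path I01 R from x to y}) :
  path_homotopic f g -> Phi f = Phi g.
Proof.
move=> fg; rewrite /Phi; case: base => // p; case: base => // q.
congr (alpha _); apply/homotopy_classP.
apply: concat_homotopic; last exact: path_homotopic_refl.
by apply: concat_homotopic => //; exact: path_homotopic_refl.
Qed.

Let PhiM x y z (f : {path I01 R from x to y}) (g : {path I01 R from y to z}) :
  Phi (concat f g) = (Phi f * Phi g)%g.
Proof.
rewrite /Phi.
case Ex : (base x) => [p|]; last first.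
  case Ey : (base y) => [q|]; last by rewrite mulg1.
  by have [p] := base_path (concat q (reverse f)); rewrite Ex.
have [q ->] := base_path (concat p f).
have [r ->] := base_path (concat (concat p f) g).
rewrite -gmulfM; congr (alpha _); rewrite homotopy_classM.
apply/homotopy_classP; apply/path_homotopic_sym.
have refl := @path_homotopic_refl R X.
apply: path_homotopic_trans (concatA _ _ _) _.
apply: (@path_homotopic_trans _ _ _ _ _
    (concat (concat p f) (concat g (reverse r)))).
  apply: concat_homotopic => //.
  apply: path_homotopic_trans; first exact/path_homotopic_sym/concatA.
  apply: concat_homotopic => //.
  apply: path_homotopic_trans; first exact/path_homotopic_sym/concatA.
  apply: path_homotopic_trans; last exact: concat_constl.
  by apply: concat_homotopic => //; exact: concat_reversel.
apply: path_homotopic_trans; first exact/path_homotopic_sym/concatA.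
by apply: concat_homotopic => //; exact: concatA.
Qed.

(* The base path chosen at x0 may be a nontrivial loop, whence the
   conjugation. *)
Lemma representation_cocycle : locally_path_connected R X ->
  semilocally_simply_connected R X ->
  exists e k, local_cocycle e /\ forall f : {path I01 R from x0 to x0},
    transport e (pathR f) = (alpha (homotopy_class f) ^ k)%g.
Proof.
move=> lpc slsc; have [e eP eE] := path_transport_cocycle lpc slsc PhiM Phi_homotopic.
have [p Ep] := base_path (const_path R x0).
exists e, (alpha (homotopy_class p))^-1%g; split=> // f.
rewrite eE /Phi Ep -!homotopy_classM -homotopy_classV !gmulfM.
by rewrite multiplicativeV conjgE invgK mulgA.
Qed.

End groupoid_extension.

(** * The punctured plane *)

Lemma flat_quotient_segment (R : realType) (T : topologicalType) (G : groupType)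
    (c : T -> T -> G) (V : normedModType R) (H : V -> T) (u v : V -> G) p q :
  (forall s : R, 0 <= s <= 1 -> flat_at c H u (p + s *: (q - p))) ->
  (forall s : R, 0 <= s <= 1 -> flat_at c H v (p + s *: (q - p))) ->
  (u p * (v p)^-1 = u q * (v q)^-1)%g.
Proof.
move=> fu fv; pose seg (s : R) := p + s *: (q - p).
have cseg s : {for s, continuous seg}.
  by apply: cvgD; [exact: cvg_cst|apply: cvgZ; [exact: cvg_id|exact: cvg_cst]].
have := @locally_constant_segment R G (fun s => u (seg s) * (v (seg s))^-1)%g
  0 1 ler01.
rewrite /seg scale0r addr0 scale1r subrKC; apply => s s01.
apply: (near_continuous (P := fun x =>
  u x * (v x)^-1 = u (seg s) * (v (seg s))^-1)%g (cseg s)).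
by apply: flat_quotient; [exact: fu|exact: fv].
Qed.

(** Four open half-spaces cover the complement of the axis in [R * (R * R)]. They are convex, cyclic
    neighbours meet in convex sets and opposite ones are disjoint, so monodromy reduces to constants
    on overlaps. *)
Inductive side := East | North | West | South.

Section punctured_plane.
Context (R : realType).

Definition height (i : side) (p : R * (R * R)) : R :=
  match i with
  | East => p.2.1 | North => p.2.2 | West => - p.2.1 | South => - p.2.2
  end.

Definition off_axis (p : R * (R * R)) : Prop := p.2 <> (0, 0).

Lemma height_off_axis i p : 0 < height i p -> off_axis p.
Proof. by move=> + p0; case: i; rewrite /height p0/= ?oppr0 ltxx. Qed.

Lemma off_axis_height p : off_axis p -> exists i, 0 < height i p.
Proof.
case: p => t [x y] xy; case: (ltgtP x 0) => x0.
- by exists West => /=; rewrite oppr_gt0.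
- by exists East.
case: (ltgtP y 0) => y0.
- by exists South => /=; rewrite oppr_gt0.
- by exists North.
by case: xy; rewrite /= x0 y0.
Qed.

Lemma height_continuous i : continuous (height i).
Proof.
have c1 : continuous (fun p : R * (R * R) => p.2.1).
  by apply: (@continuous_comp_fun _ (R * R)%type); [exact: continuous_snd|exact: continuous_fst].
have c2 : continuous (fun p : R * (R * R) => p.2.2).
  by apply: (@continuous_comp_fun _ (R * R)%type); [exact: continuous_snd|exact: continuous_snd].
by case: i => //= p; apply: cvgN; [exact: c1|exact: c2].
Qed.

Lemma height_segment i (s : R) p q :
  height i (p + s *: (q - p)) = (1 - s) * height i p + s * height i q.
Proof.
case: i; case: p q => [t [x y]] [t' [x' y']]; rewrite /height /=;
  rewrite /GRing.scale/=; ring.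
Qed.

Lemma height_convex i (s : R) p q : 0 < height i p -> 0 < height i q ->
  0 <= s <= 1 -> 0 < height i (p + s *: (q - p)).
Proof.
move=> hp hq /andP[s0 s1]; rewrite height_segment.
have [->|sn0] := eqVneq s 0; first by rewrite subr0 mul1r mul0r addr0.
by rewrite ltr_wpDl ?mulr_ge0 ?mulr_gt0 ?subr_ge0 ?(ltW hp)// lt0r sn0.
Qed.

Lemma height_open i : open [set p | 0 < height i p].
Proof.
rewrite (_ : mkset _ = height i @^-1` [set x | 0 < x]) //.
by apply: open_comp => [p _|]; [exact: height_continuous|exact: open_gt].
Qed.

Lemma near_height i p : 0 < height i p -> \forall q \near p, 0 < height i q.
Proof. by move=> ip; exact: (near_continuous (@height_continuous i p) (lt_nbhsr ip)). Qed.

Context (T : topologicalType) (G : groupType) (c : T -> T -> G).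
Hypothesis cP : local_cocycle c.
Context (F : R * (R * R) -> T).
Hypothesis cF : forall p, off_axis p -> {for p, continuous F}.

(* k is the monodromy around the axis, read on the half-plane East. *)
Definition atlas (u : side -> R * (R * R) -> G) (k : G) : Prop :=
  [/\ forall i p, 0 < height i p -> flat_at c F (u i) p,
      forall p, 0 < height East p -> 0 < height North p -> u East p = u North p,
      forall p, 0 < height North p -> 0 < height West p -> u North p = u West p,
      forall p, 0 < height West p -> 0 < height South p -> u West p = u South p &
      forall p, 0 < height South p -> 0 < height East p ->
        u South p = (k * u East p)%g].

(** On a convex overlap two flat functions differ by a constant. Absorbing the first three constants
    into the functions pushes the product of all four into the overlap of South and East. *)
Lemma atlas_exists : exists u k, atlas u k.
Proof.
have /choice[v fv] : forall i, exists v : R * (R * R) -> G,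
    forall p, 0 < height i p -> flat_at c F v p.
  move=> i; pose p0 : R * (R * R) := (0, match i with
    East => (1, 0) | North => (0, 1) | West => (- 1, 0) | South => (0, - 1) end).
  have hp0 : 0 < height i p0 by rewrite /p0 {p0}; case: i => /=; rewrite ?opprK ltr01.
  have [||w fw] := @flat_star _ _ _ cP R _ F _ p0 (@height_open i).
  - by move=> q s /= hq s01; exact: height_convex.
  - by move=> q /= /height_off_axis; exact: cF.
  - by exists w.
have overlap i j : exists k, forall p, 0 < height i p -> 0 < height j p ->
    v i p = (k * v j p)%g.
  have [[p [pi_ pj]]|none] := pselect (exists p, 0 < height i p /\ 0 < height j p).
    exists (v i p * (v j p)^-1)%g => q qi qj.
    rewrite (@flat_quotient_segment _ _ _ c _ F (v i) (v j) p q) ?mulgVK//.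
      by move=> s s01; apply: fv; exact: height_convex.
    by move=> s s01; apply: fv; exact: height_convex.
  by exists 1%g => p pi_ pj; case: none; exists p.
have [a aP] := overlap East North; have [b bP] := overlap North West.
have [d dP] := overlap West South; have [e eP] := overlap South East.
exists (fun i p => match i with East => v East p | North => a * v North p
  | West => a * b * v West p | South => a * b * d * v South p end)%g.
exists (a * b * d * e)%g; split.
- by case=> p hp; try (apply: flat_mull_cst); exact: fv.
- exact: aP.
- by move=> p pn pw; rewrite (bP p)// mulgA.
- by move=> p pw ps; rewrite (dP p)// !mulgA.
- by move=> p ps pe; rewrite (eP p)// !mulgA.
Qed.

Context (u : side -> R * (R * R) -> G) (k : G).
Hypothesis uk : atlas u k.

Definition circle (t r a : R) : R * (R * R) := (t, (r * cos a, r * sin a)).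

Lemma circle_continuous t r : continuous (circle t r).
Proof.
apply: continuous_pair; first by move=> a; exact: cvg_cst.
apply: continuous_pair => a; (apply: cvgM; first exact: cvg_cst).
  exact: continuous_cos.
exact: continuous_sin.
Qed.

Lemma circle_off_axis t r a : 0 < r -> off_axis (circle t r a).
Proof.
move=> r0 [] /eqP + /eqP; rewrite !mulf_eq0 gt_eqF//= => /eqP c0 /eqP s0.
by have := cos2Dsin2 a; rewrite c0 s0 expr0n addr0 => /eqP; rewrite eq_sym oner_eq0.
Qed.

(** The quotient [d i] of [w] by [u i] is constant while the circle stays in half-space [i] and
    survives each change of half-space, except from South to East, where it gains [k] on the
    right. *)
Lemma circle_holonomy t r (w : R -> G) : 0 < r ->
  (forall a, 0 <= a <= 2 * pi -> flat_at c (F \o circle t r) w a) ->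
  let v := u East (circle t r 0) in
  (w (2 * pi)%R = w 0%R * (v^-1 * k * v))%g.
Proof.
have [fu EN NW WS SE] := uk.
move=> r0 fw v.
have pi0 := @pi_gt0 R.
pose d i a := (w a * (u i (circle t r a))^-1)%g.
have arc i a b : 0 <= a -> a <= b -> b <= 2 * pi ->
    (forall x, a <= x <= b -> 0 < height i (circle t r x)) -> d i a = d i b.
  move=> a0 ab b2 hi; apply: (@locally_constant_segment R G (d i)) => // s sab.
  apply: (@flat_quotient _ _ c _ (F \o circle t r) w (u i \o circle t r)).
    by apply: fw; lra.
  by apply: flat_comp; [exact: circle_continuous|exact: fu (hi _ sab)].
have cos1 x : - (pi / 2) < x < pi / 2 -> 0 < r * cos x.
  by move=> ?; rewrite pmulr_rgt0// cos_gt0_pihalf.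
have sin1 x : 0 < x < pi -> 0 < r * sin x.
  by move=> ?; rewrite pmulr_rgt0// sin_gt0_pi.
have hE x : - (pi / 2) < x < pi / 2 -> 0 < height East (circle t r x) by exact: cos1.
have hN x : 0 < x < pi -> 0 < height North (circle t r x) by exact: sin1.
have hW x : pi / 2 < x < 3 * (pi / 2) -> 0 < height West (circle t r x).
  move=> xx; rewrite /= -mulrN -[x](subrK pi) cosDpi opprK; apply: cos1; lra.
have hS x : pi < x < 2 * pi -> 0 < height South (circle t r x).
  move=> xx; rewrite /= -mulrN -[x](subrK pi) sinDpi opprK; apply: sin1; lra.
have hE' x : 3 * (pi / 2) < x < 5 * (pi / 2) -> 0 < height East (circle t r x).
  move=> xx; rewrite /= -[x](subrK (pi *+ 2)) cosD2pi; apply: cos1; lra.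
(* Odd multiples of [h] are the diagonal directions, where consecutive half-spaces overlap. *)
pose h := (pi : R) / 4.
have swap i j a : u i (circle t r a) = u j (circle t r a) -> d i a = d j a.
  by move=> e; rewrite /d e.
have E01 : d East 0 = d East h.
  by apply: arc => [|||x xh]; [lra|rewrite /h; lra|rewrite /h; lra|apply: hE; move: xh; rewrite /h; lra].
have EN1 : d East h = d North h.
  by apply: swap; apply: EN; [apply: hE|apply: hN]; rewrite /h; lra.
have N13 : d North h = d North (3 * h).
  by apply: arc => [|||x xh]; [rewrite /h; lra..|apply: hN; move: xh; rewrite /h; lra].
have NW3 : d North (3 * h) = d West (3 * h).
  by apply: swap; apply: NW; [apply: hN|apply: hW]; rewrite /h; lra.
have W35 : d West (3 * h) = d West (5 * h).
  by apply: arc => [|||x xh]; [rewrite /h; lra..|apply: hW; move: xh; rewrite /h; lra].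
have WS5 : d West (5 * h) = d South (5 * h).
  by apply: swap; apply: WS; [apply: hW|apply: hS]; rewrite /h; lra.
have S57 : d South (5 * h) = d South (7 * h).
  by apply: arc => [|||x xh]; [rewrite /h; lra..|apply: hS; move: xh; rewrite /h; lra].
have SE7 : (d South (7 * h)%R * k = d East (7 * h)%R)%g.
  rewrite /d SE; first by rewrite invgM mulgA mulgVK.
    by apply: hS; rewrite /h; lra.
  by apply: hE'; rewrite /h; lra.
have E78 : d East (7 * h) = d East (2 * pi).
  by apply: arc => [|||x xh]; [rewrite /h; lra..|apply: hE'; move: xh; rewrite /h; lra].
have : d East (2 * pi) = (d East 0%R * k)%g.
  by rewrite -E78 -SE7 -S57 -WS5 -W35 -NW3 -N13 -EN1 -E01.
rewrite {1 2}/d (_ : circle t r (2 * pi) = circle t r 0); last first.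
  by rewrite /circle mulr_natl cos2pi sin2pi cos0 sin0.
by rewrite -/v => /(congr1 (fun x => x * v)%g); rewrite mulgVK !mulgA.
Qed.

Lemma circle_closed t r a : circle t r (a + 2 * pi) = circle t r a.
Proof. by rewrite /circle mulr_natl cosD2pi sinD2pi. Qed.

Section loops.
Hypothesis kk : (k * k = 1)%g.

Lemma atlas_overlap i j p : 0 < height i p -> 0 < height j p ->
  (u i p * (u j p)^-1 = 1 \/ u i p * (u j p)^-1 = k)%g.
Proof.
have [fu EN NW WS SE] := uk.
have kV : k^-1%g = k by exact: mulg1_eq.
have no (x : R) : 0 < x -> 0 < - x -> False by lra.
case: i; case: j => pi_ pj; try (by left; rewrite mulgV);
  try (by case: (no _ pi_ pj)); try (by case: (no _ pj pi_)).
- by left; rewrite EN// mulgV.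
- by right; rewrite SE// invgM mulgA mulgV mul1g.
- by left; rewrite EN// mulgV.
- by left; rewrite NW// mulgV.
- by left; rewrite NW// mulgV.
- by left; rewrite WS// mulgV.
- by right; rewrite SE// mulgK.
- by left; rewrite WS// mulgV.
Qed.

(** In place of a winding number: the quotient of [w] by the atlas stays in the two-element set [C],
    since changing half-space multiplies it by 1 or [k] and [k * k = 1]. Back at the start, the
    transport is 1 or a conjugate of [k]. *)
Lemma atlas_loop (g : R -> R * (R * R)) (w : R -> G) : continuous g ->
  (forall s, off_axis (g s)) -> g 0 = g 1 ->
  (forall s, 0 <= s <= 1 -> flat_at c (F \o g) w s) ->
  let x := ((w 0%R)^-1 * w 1%R)%g in (x * x = 1)%g.
Proof.
move=> cg og g01 fw x; have [fu _ _ _ _] := uk.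
have [i0 hi0] := off_axis_height (og 0).
pose d i s := (w s * (u i (g s))^-1)%g.
pose C z := z = d i0 0 \/ z = (d i0 0%R * k)%g.
pose S s := forall i, 0 < height i (g s) -> C (d i s).
have CS s i j : 0 < height i (g s) -> 0 < height j (g s) -> C (d i s) -> C (d j s).
  move=> si sj; have -> : d j s = (d i s * (u i (g s) * (u j (g s))^-1))%g.
    by rewrite mulgA mulgVK.
  have kk' z : (z * k * k = z)%g by rewrite -mulgA kk mulg1.
  by case: (atlas_overlap si sj) => ->; rewrite ?mulg1// => -[] ->; rewrite ?kk'; [right|left].
have S0 : S 0 by move=> i hi; apply: (CS _ i0) => //; left.
have S1 : S 1.
  suff: S 0 -> S 1 by exact.
  apply: (@interval_induction R (fun a b => S a -> S b)) => //.
  - by move=> a b e _ _ _ _ ab be /ab /be.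
  - move=> s s01; have [j hj] := off_axis_height (og s).
    have n1 := near_continuous (cg s) (near_height hj).
    have n2 : \forall s' \near s, d j s' = d j s.
      apply: (@flat_quotient _ _ c _ (F \o g) w (u j \o g)); first exact: fw.
      by apply: flat_comp; [exact: cg|exact: fu].
    exists (fun s' => 0 < height j (g s') /\ d j s' = d j s).
      by move: n1 n2; apply: filterS2.
    move=> a b [ja da] [jb db] _ _ _ _ Sa i hi.
    by apply: (CS _ j) => //; rewrite db -da; exact: Sa.
have : C (d i0 1) by apply: S1; rewrite -g01.
rewrite /C /d -g01; set v := u i0 (g 0) => -[|] /(congr1 (fun z => z * v)%g);
  rewrite mulgVK => e.
- by rewrite /x e mulgVK mulVg mulg1.
- have -> : x = (v^-1 * k * v)%g by rewrite /x e !mulgA mulVg mul1g.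
  by rewrite !mulgA mulgK -(mulgA _ k k) kk mulg1 mulVg.
Qed.

End loops.

Lemma atlas_total : k = 1%g -> exists v, forall p, off_axis p -> flat_at c F v p.
Proof.
move=> k1; have [fu _ _ _ _] := uk.
have eu i j p : 0 < height i p -> 0 < height j p -> u i p = u j p.
  have kk : (k * k = 1)%g by rewrite k1 mulg1.
  by move=> pi_ pj; case: (atlas_overlap kk pi_ pj); rewrite ?k1 => /divg1_eq.
pose v p := if 0 < height East p then u East p
  else if 0 < height North p then u North p
  else if 0 < height West p then u West p else u South p.
have vE i p : 0 < height i p -> v p = u i p.
  move=> hi; rewrite /v; case: ifPn => [hE|nE]; first exact: eu.
  case: ifPn => [hN|nN]; first exact: eu.
  case: ifPn => [hW|nW]; first exact: eu.
  by case: i hi => // hi; [rewrite hi in nE|rewrite hi in nN|rewrite hi in nW].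
exists v => p /off_axis_height[i hi].
apply: flat_near (fu i p hi); first exact: filterE.
by have := near_height hi; apply: filterS => q /vE ->.
Qed.

End punctured_plane.

(** * The complement of a knot *)

Lemma continuous_at_near (X Y : topologicalType) (f g : X -> Y) x :
  (\forall x' \near x, f x' = g x') -> {for x, continuous f} ->
  {for x, continuous g}.
Proof.
move=> fg cf U; rewrite -(nbhs_singleton fg) => fU.
by move: fg (near_continuous cf fU); apply: filterS2 => x' /= <-.
Qed.

Section set_type_topology.
Context (X : topologicalType) (A : set X).

Lemma val_set_type_continuous : continuous (\val : set_type A -> X).
Proof. exact: initial_continuous. Qed.

Lemma continuous_at_set_type (Z : topologicalType) (g : Z -> set_type A) z :
  {for z, continuous (fun z' => \val (g z'))} -> {for z, continuous g}.
Proof.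
move=> cg U [_ [[B oB <-] Bgz BU]].
have := near_continuous cg (open_nbhs_nbhs (conj oB Bgz)).
by apply: filterS => z' Bz'; exact: BU.
Qed.

Lemma set_type_hausdorff : hausdorff_space X -> hausdorff_space (set_type A).
Proof.
move=> hX p q pq; apply: val_inj; apply: hX => B C pB qC.
have [r [Br Cr]] := pq _ _ (near_continuous (@val_set_type_continuous p) pB)
  (near_continuous (@val_set_type_continuous q) qC).
by exists (\val r).
Qed.

End set_type_topology.

Lemma ball_segment (R : realType) (E : normedModType R) (a v w : E) (r s : R) : 0 <= s <= 1 -> ball a r v -> ball a r w ->
  ball a r ((1 - s) *: v + s *: w).
Proof.
move=> /andP[s0 s1]; rewrite -ball_normE /= => av aw.
have -> : a - ((1 - s) *: v + s *: w) = (1 - s) *: (a - v) + s *: (a - w).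
  by rewrite !scalerBr addrACA -scalerDl subrK scale1r opprD.
apply: le_lt_trans (ler_normD _ _) _; rewrite !normrZ !ger0_norm ?subr_ge0//.
have [->|sn0] := eqVneq s 0; first by rewrite subr0 mul1r mul0r addr0.
have sp : 0 < s by rewrite lt0r sn0.
have : s * `|a - w| < s * r by rewrite ltr_pM2l.
have : (1 - s) * `|a - v| <= (1 - s) * r by rewrite ler_wpM2l ?subr_ge0// ltW.
lra.
Qed.

Section neighbourhood_retract.
Context (R : realType) (E : normedModType R) (X : topologicalType).
Context (iota : X -> E) (q : E -> X).
Hypotheses (ciota : continuous iota) (iotaK : cancel iota q).
Hypothesis cq : forall x, \forall v \near iota x, {for v, continuous q}.

Let segment_continuous (Z : topologicalType) (r : Z -> R) (v w : Z -> E) :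
  continuous r -> continuous v -> continuous w ->
  continuous (fun z => (1 - r z) *: v z + r z *: w z).
Proof.
move=> cr cv cw z; apply: cvgD.
  by apply: cvgZ; [apply: cvgB; [exact: cvg_cst|exact: cr]|exact: cv].
by apply: cvgZ; [exact: cr|exact: cw].
Qed.

(** [q] maps straight segments of [E] back to paths in [X]; the ball is chosen so that [q] is
    continuous on it and sends it into [W]. *)
Lemma retract_locally_path_connected : locally_path_connected R X.
Proof.
move=> x W xW.
have /nbhs_ballP[r /= r0 rP] : \forall v \near iota x, {for v, continuous q} /\ W (q v).
  have n1 := cq x; have qx := nbhs_singleton n1.
  rewrite -[x in nbhs x W]iotaK in xW.
  by have n2 := near_continuous qx xW; move: n1 n2; apply: filterS2.
exists (iota @^-1` ball (iota x) r).
  by apply: (near_continuous (@ciota x)); exact: nbhsx_ballx.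
move=> y z yb zb.
pose g (t : I01 R) := (1 - \val t) *: iota y + \val t *: iota z.
have gb t : ball (iota x) r (g t) by apply: ball_segment => //; exact: I01P.
have cg : continuous (q \o g).
  move=> t; apply: continuous_comp; last exact: (rP _ (gb t)).1.
  apply: (@segment_continuous _ (fun t : I01 R => \val t) (fun=> iota y)
    (fun=> iota z)).
  - exact: val_continuous.
  - exact: cst_continuous.
  - exact: cst_continuous.
have g0 : (q \o g) zero = y.
  by rewrite /g /comp val_zero subr0 scale1r scale0r addr0 iotaK.
have g1 : (q \o g) one = z.
  by rewrite /g /comp val_one subrr scale1r scale0r add0r iotaK.
by exists (mk_path cg g0 g1) => t; exact: (rP _ (gb t)).2.
Qed.

(** The image under [q] of the straight-line homotopy, which stays in a ball where [q] is
    continuous. *)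
Lemma retract_semilocally_simply_connected : semilocally_simply_connected R X.
Proof.
move=> x; have /nbhs_ballP[r /= r0 rP] := cq x.
exists (iota @^-1` ball (iota x) r).
  by apply: (near_continuous (@ciota x)); exact: nbhsx_ballx.
move=> y z f g fb gb.
pose h (p : I01 R * I01 R) :=
  (1 - \val p.2) *: iota (f p.1) + \val p.2 *: iota (g p.1).
exists (q \o h); split.
- move=> p; apply: continuous_comp; last first.
    by apply: rP; apply: ball_segment; [exact: I01P|exact: fb|exact: gb].
  have cf (k : {path I01 R from y to z}) :
      continuous (fun p : I01 R * I01 R => iota (k p.1)).
    apply: continuous_comp_fun ciota.
    by apply: continuous_comp_fun; [exact: continuous_fst|exact: cts_fun].
  apply: (@segment_continuous _ (fun p : I01 R * I01 R => \val p.2)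
    (fun p => iota (f p.1)) (fun p => iota (g p.1))).
  - exact: continuous_val2.
  - exact: cf.
  - exact: cf.
- by move=> t; rewrite /h /comp /snd val_zero subr0 scale1r scale0r addr0 iotaK.
- by move=> t; rewrite /h /comp /snd val_one subrr scale1r scale0r add0r iotaK.
- by move=> s; rewrite /h /comp !path_zero -scalerDl subrK scale1r iotaK.
- by move=> s; rewrite /h /comp !path_one -scalerDl subrK scale1r iotaK.
Qed.

End neighbourhood_retract.

Section knot_complement_topology.
Context (R : realType).

Let norm2 (v : 'rV[R]_4) : R := \sum_i v 0 i ^+ 2.

Let norm2_continuous : continuous norm2.
Proof.
rewrite /norm2; elim: (index_enum _) => [|i s IHs].
  rewrite (_ : (fun v => _) = fun=> 0); first exact: cst_continuous.
  by apply/funext => v; rewrite big_nil.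
rewrite (_ : (fun v => _) =
    fun v : 'rV[R]_4 => v 0 i * v 0 i + \sum_(j <- s) v 0 j ^+ 2).
  apply: continuous_addR => //.
  by apply: continuous_mulR; exact: coord_continuous.
by apply/funext => v; rewrite big_cons expr2.
Qed.

Let norm2_normalize (v : 'rV[R]_4) : 0 < norm2 v ->
  (Num.sqrt (norm2 v))^-1 *: v \in [set v : 'rV[R]_4 | \sum_i v 0 i ^+ 2 = 1].
Proof.
move=> v0; rewrite inE /=.
under eq_bigr do rewrite mxE exprMn.
by rewrite -mulr_sumr exprVn sqr_sqrtr ?ltW// mulVf ?gt_eqF.
Qed.

Context (K : set (sphere R 3)).
Hypothesis cK : closed K.

Let to_sphere (y : sphere R 3) (v : 'rV[R]_4) : sphere R 3 :=
  match pselect (0 < norm2 v) with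
  | left v0 => SigSub (norm2_normalize v0)
  | right _ => y
  end.

Let to_sphereE y v : 0 < norm2 v ->
  \val (to_sphere y v) = (Num.sqrt (norm2 v))^-1 *: v.
Proof. by move=> v0; rewrite /to_sphere; case: pselect. Qed.

Let near_norm2 v : 0 < norm2 v -> \forall w \near v, 0 < norm2 w.
Proof.
by move=> v0; have := near_continuous (@norm2_continuous v) (lt_nbhsr v0); apply.
Qed.

Let to_sphere_continuous y v : 0 < norm2 v ->
  {for v, continuous (to_sphere y)}.
Proof.
move=> v0; apply: continuous_at_set_type.
have cN : {for v, continuous (fun w : 'rV[R]_4 => (Num.sqrt (norm2 w))^-1 *: w)}.
  have cs : {for v, continuous (fun w => (Num.sqrt (norm2 w))^-1)}.
    apply: (@continuousV R _ (fun w => Num.sqrt (norm2 w))).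
      by rewrite gt_eqF// sqrtr_gt0.
    by apply: (continuous_comp (@norm2_continuous v)); exact: sqrt_continuous.
  by have := cvgZ cs (@cvg_id _ (nbhs v)); apply; exact: nbhs_filter.
have e := near_norm2 v0.
apply: continuous_at_near cN.
by move: e; apply: filterS => w w0; rewrite to_sphereE.
Qed.

(** [q] is radial projection to the sphere, with default [x0] at the origin and at vectors
    projecting into [K]. Near the complement these defaults do not occur, because [K] is closed. *)
Lemma knot_complement_retract (x0 : knot_complement K) :
  exists q : 'rV[R]_4 -> knot_complement K,
    cancel (fun x : knot_complement K => \val (\val x)) q /\
    forall x : knot_complement K, \forall v \near (\val (\val x) : 'rV[R]_4), {for v, continuous q}.
Proof.
pose ts := to_sphere (\val x0).
pose q v : knot_complement K := insubd x0 (ts v).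
have qE v : ts v \in ~` K -> \val (q v) = ts v by move=> Kv; exact: insubdK.
have norm2_val (x : sphere R 3) : norm2 (\val x) = 1.
  by case: x => v /= /set_mem.
have ts_val (x : sphere R 3) : ts (\val x) = x.
  apply: val_inj; rewrite to_sphereE norm2_val ?ltr01//.
  by rewrite sqrtr1 invr1 scale1r.
exists q; split=> [x|x].
  by apply: val_inj; rewrite qE ts_val//; exact: valP.
have v0 : 0 < norm2 (\val (\val x)) by rewrite norm2_val ltr01.
have ox : nbhs (ts (\val (\val x))) (~` K).
  apply: open_nbhs_nbhs; split; first exact: closed_openC.
  by rewrite ts_val; apply/set_mem; exact: valP.
have n1 := near_continuous (@to_sphere_continuous (\val x0) _ v0) ox.
move: n1 (near_norm2 v0); apply: filterS2 => v Kv v1.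
have nv : \forall w \near v, ts w \in ~` K.
  have ov : nbhs (ts v) (~` K).
    by apply: open_nbhs_nbhs; split=> //; exact: closed_openC.
  have := near_continuous (@to_sphere_continuous (\val x0) _ v1) ov.
  by apply: filterS => w Kw; rewrite inE.
apply: continuous_at_set_type.
apply: continuous_at_near (@to_sphere_continuous (\val x0) _ v1).
by move: nv; apply: filterS => w /qE ->.
Qed.

Let iota_continuous :
  continuous (fun x : knot_complement K => \val (\val x) : 'rV[R]_4).
Proof.
apply: continuous_comp_fun.
  exact: (@val_set_type_continuous _ (~` K)).
exact: (@val_set_type_continuous _ [set v : 'rV[R]_4 | \sum_i v 0 i ^+ 2 = 1]).
Qed.

Lemma knot_complement_locally_path_connected :
  locally_path_connected R (knot_complement K).
Proof.
move=> x; have [q [qK cq]] := knot_complement_retract x.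
exact: (retract_locally_path_connected iota_continuous qK cq).
Qed.

Lemma knot_complement_semilocally_simply_connected :
  semilocally_simply_connected R (knot_complement K).
Proof.
move=> x; have [q [qK cq]] := knot_complement_retract x.
exact: (retract_semilocally_simply_connected iota_continuous qK cq).
Qed.

End knot_complement_topology.

(** * Monodromy around a knot *)

Section knot_parametrization.
Context (R : realType).

Let row2 (a b : R) : 'rV[R]_2 := a *: delta_mx 0 0 + b *: delta_mx 0 1.

Let row2E a b : row2 a b 0 0 = a /\ row2 a b 0 1 = b.
Proof. by rewrite !mxE/= !(mulr0, mulr1, addr0, add0r). Qed.

Let sum2 (v : 'rV[R]_2) : \sum_i v 0 i ^+ 2 = v 0 0 ^+ 2 + v 0 1 ^+ 2.
Proof.
by rewrite !big_ord_recl big_ord0 addr0; congr (v 0 _ ^+ 2 + v 0 _ ^+ 2); exact: val_inj.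
Qed.

Let unit_row2 (a : R) :
  row2 (cos a) (sin a) \in [set v : 'rV[R]_2 | \sum_i v 0 i ^+ 2 = 1].
Proof. by rewrite inE/= sum2 !(row2E _ _).1 !(row2E _ _).2 cos2Dsin2. Qed.

Let angle (a : R) : sphere R 1 := SigSub (unit_row2 a).

Let angle_continuous : continuous angle.
Proof.
move=> a; apply: continuous_at_set_type; apply: cvgD.
  by apply: cvgZ; [exact: continuous_cos|exact: cvg_cst].
by apply: cvgZ; [exact: continuous_sin|exact: cvg_cst].
Qed.

Let angle_surjective (y : sphere R 1) : exists2 a, 0 <= a <= 2 * pi & angle a = y.
Proof.
case: y => v v1; have := v1; rewrite inE /= sum2.
set x := v 0 0; set z := v 0 1 => xz.
have x1 : -1 <= x <= 1.
  rewrite -ler_norml -(@ler_pXn2r _ 2)// ?nnegrE// expr1n real_normK ?num_real//.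
  by rewrite -xz lerDl sqr_ge0.
have sx : sin (acos x) = `|z|.
  by rewrite sin_acos// -xz addrAC subrr add0r sqrtr_sqr.
have a0 := acos_ge0 x1; have api := acos_lepi x1.
have [a a02 [ca sa]] : exists2 a, 0 <= a <= 2 * pi & cos a = x /\ sin a = z.
  have [z0|z0] := leP 0 z.
    exists (acos x); last by rewrite acosK ?in_itv// sx ger0_norm.
    by rewrite a0/=; have := @pi_ge0 R; lra.
  exists (- acos x + pi *+ 2); first by rewrite -mulr_natl; lra.
  by rewrite cosD2pi sinD2pi cosN sinN acosK ?in_itv// sx ltr0_norm// opprK.
exists a => //; apply: val_inj => /=; rewrite ca sa.
apply/rowP => i; have [e0 e1] := row2E x z.
case: i => [[|[|//]] lti2].
  by rewrite (_ : Ordinal _ = 0)//; exact: val_inj.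
by rewrite (_ : Ordinal _ = 1)//; exact: val_inj.
Qed.

(** The angle on the circle exhibits [K] as the image of a closed interval, whence its closedness
    and connectedness. *)
Lemma knot_parametrization (K : set (sphere R 3)) : is_knot K ->
  exists k : R -> sphere R 3,
    [/\ continuous k, forall a, K (k a) & K `<=` k @` `[0, 2 * pi]].
Proof.
move=> [[f [cf _ fK]] _]; exists (f \o angle); split.
- by move=> a; apply: continuous_comp; [exact: angle_continuous|exact: cf].
- by move=> a; rewrite -fK; exists (angle a).
move=> y; rewrite -fK => -[x _ <-]; have [a a02 <-] := angle_surjective x.
by exists a => //=; rewrite in_itv.
Qed.

Lemma knot_closed (K : set (sphere R 3)) : is_knot K -> closed K.
Proof.
move=> /knot_parametrization[k [ck kK Kk]].
have -> : K = k @` `[0, 2 * pi].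
  by apply/seteqP; split=> // _ [a _ <-].
apply: compact_closed.
  exact: (set_type_hausdorff (@norm_hausdorff _ _)).
apply: continuous_compact; last exact: segment_compact.
exact: continuous_subspaceT.
Qed.

Lemma knot_connected (K : set (sphere R 3)) (P : sphere R 3 -> Prop) :
  is_knot K ->
  (forall y, K y -> \forall z \near y, K z -> P z = P y) ->
  forall y z, K y -> K z -> P y -> P z.
Proof.
move=> /knot_parametrization[k [ck kK Kk]] lP.
suff e a : 0 <= a <= 2 * pi -> P (k 0) = P (k a).
  move=> y z /Kk[a + <-] /Kk[b + <-]; rewrite /= !in_itv/= => a02 b02.
  by rewrite -(e a)// -(e b).
move=> /andP[a0 _]; apply: (@locally_constant_segment R _ (fun t => P (k t))) => //.
move=> s _; have := near_continuous (@ck s) (lP _ (kK s)).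
by apply: filterS => t /(_ (kK t)).
Qed.

End knot_parametrization.

Lemma complex_square_eq0 (R : realType) (z : R * R) :
  complex_square z = (0, 0) <-> z = (0, 0).
Proof.
case: z => x y; split=> [|[-> ->]]; last first.
  by rewrite /complex_square/= expr0n/= subrr mulr0.
move=> [] /eqP; rewrite subr_eq0 eqf_sqr => xy /eqP.
rewrite !mulf_eq0 pnatr_eq0/= => /orP[/eqP x0|/eqP y0].
  by move: xy; rewrite x0 !(eq_sym 0) oppr_eq0 orbb => /eqP ->.
by move: xy; rewrite y0 oppr0 orbb => /eqP ->.
Qed.

Section circle_transport.
Context (R : realType) (T : topologicalType) (G : groupType) (c : T -> T -> G).
Hypothesis cP : local_cocycle c.
Context (F : R * (R * R) -> T).
Hypothesis cF : forall p, off_axis p -> {for p, continuous F}.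
Context (u : side -> R * (R * R) -> G) (k : G).
Hypothesis uk : atlas c F u k.

Let circle_flat t r : 0 < r ->
  exists w : R -> G, forall a, flat_at c (F \o circle t r) w a.
Proof.
move=> r0; apply: (flat_total cP) => a.
by apply: continuous_comp; [exact: circle_continuous|exact/cF/circle_off_axis].
Qed.

(** [phi] covers two uses: the identity, and the clamped parameter by which [pathR] extends a
    meridian to the line. *)
Lemma circle_transport t r (phi : R -> R) : 0 < r -> continuous phi ->
  phi 0 = 0 -> phi 1 = 1 ->
  let v := u East (circle t r 0) in
  transport c (fun s => F (circle t r (2 * pi * phi s))) = (v^-1 * k * v)%g.
Proof.
move=> r0 cphi phi0 phi1 v; have [w fw] := circle_flat t r0.
have cturn : continuous (fun s => 2 * pi * phi s).
  by apply: continuous_mulR => //; exact: cst_continuous.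
rewrite (transportE cP (w := fun s => w (2 * pi * phi s)%R)).
- rewrite phi0 phi1 mulr0 mulr1 (circle_holonomy uk r0 (fun a _ => fw a)) -/v.
  by rewrite mulKg.
- move=> s; apply: (@continuous_comp _ _ _ (fun s => circle t r (2 * pi * phi s)) F).
    by apply: (continuous_comp (cturn s)); exact: circle_continuous.
  exact/cF/circle_off_axis.
- move=> s _; apply: (@flat_comp _ _ _ _ _ (fun s => 2 * pi * phi s)
    (F \o circle t r) w) => //; exact: cturn.
Qed.

Lemma square_conj (x v : G) : (v^-1 * x * v * (v^-1 * x * v) = 1 -> x * x = 1)%g.
Proof.
rewrite !mulgA mulgK => /(congr1 (fun y => v * y * v^-1)%g).
by rewrite mulg1 mulgV !mulgA mulgV mul1g mulgK.
Qed.

(* Squaring is the double cover of the punctured plane: the monodromy upstairs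
   is the square of the monodromy downstairs. *)
Lemma squared_flat : (k * k = 1)%g ->
  exists v, forall p, off_axis p ->
    flat_at c (fun q : R * (R * R) => F (q.1, complex_square q.2)) v p.
Proof.
move=> kk; pose sq (q : R * (R * R)) := (q.1, complex_square q.2).
have csq : continuous sq.
  apply: continuous_pair; first exact: continuous_fst.
  have c1 : continuous (fun p : R * (R * R) => p.2.1).
    by apply: (@continuous_comp_fun _ (R * R)%type); [exact: continuous_snd|exact: continuous_fst].
  have c2 : continuous (fun p : R * (R * R) => p.2.2).
    by apply: (@continuous_comp_fun _ (R * R)%type); [exact: continuous_snd|exact: continuous_snd].
  apply: continuous_pair.
    by apply: continuous_subR; apply: continuous_mulR.
  apply: continuous_mulR => //; apply: continuous_mulR => //.
  exact: cst_continuous.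
have sq_off q : off_axis q -> off_axis (sq q).
  by move=> oq /complex_square_eq0.
have cFsq p : off_axis p -> {for p, continuous (F \o sq)}.
  by move=> op; apply: continuous_comp; [exact: csq|exact/cF/sq_off].
have [u' [k' uk']] := atlas_exists cP cFsq.
have sq_circle a : sq (circle 0 1 a) = circle 0 1 (2 * a).
  have -> : 2 * a = a + a by ring.
  rewrite /sq /circle /complex_square /= !mul1r cosD sinD.
  by congr (_, (_, _)); ring.
have [w fw] := circle_flat 0 ltr01.
have cshift : continuous (fun a : R => a + 2 * pi).
  by apply: continuous_addR; [move=> a; exact: cvg_id|exact: cst_continuous].
have cdouble : continuous (fun a : R => 2 * a).
  by apply: continuous_mulR; [exact: cst_continuous|move=> a; exact: cvg_id].
(* By periodicity the one-turn formula applies again, from [2 * pi] to [4 * pi]. *)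
have fw2 a : flat_at c (F \o circle 0 1) (fun a => w (a + 2 * pi)%R) a.
  have := flat_comp (g := fun a : R => (a + 2 * pi : R)) (@cshift a) (fw _).
  apply: flat_near.
    by apply: filterE => b; rewrite /= circle_closed.
  exact: filterE.
have fw' a : flat_at c (F \o sq \o circle 0 1) (fun a => w (2 * a)%R) a.
  have := flat_comp (g := fun a : R => (2 * a : R)) (@cdouble a) (fw _).
  apply: flat_near.
    by apply: filterE => b; rewrite /= sq_circle.
  exact: filterE.
have w2 := circle_holonomy uk ltr01 (fun a _ => fw a).
have w4 := circle_holonomy uk ltr01 (fun a _ => fw2 a).
have := circle_holonomy uk' ltr01 (fun a _ => fw' a); cbv beta.
(* One turn upstairs is two turns downstairs. If [w] returns to its value after them, a conjugate of
   [k'] is 1, hence [k'] is. *)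
suff -> : w (2 * (2 * pi))%R = w (2 * 0)%R.
  move=> /(congr1 (fun x => (w (2 * 0)%R)^-1 * x)%g); rewrite mulVg mulKg => /esym e.
  apply: (atlas_total uk'); move: e; set v := u' _ _ => e.
  have := congr1 (fun x => v * x * v^-1)%g e.
  by rewrite mulg1 mulgV !mulgA mulgV mul1g mulgK.
move: w4; cbv beta; rewrite add0r w2 mulr0 => w4.
have -> : 2 * (2 * pi) = 2 * pi + 2 * pi :> R by ring.
rewrite w4 -mulgA; set v := u _ _.
by rewrite !mulgA mulgK -(mulgA _ k k) kk mulg1 mulgVK.
Qed.

End circle_transport.

Section complement_map.
Context (R : realType) (K : set (sphere R 3)).
Hypothesis cK : closed K.
Context (x0 : knot_complement K).

Definition to_complement (y : sphere R 3) : knot_complement K := insubd x0 y.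

Lemma to_complementE y : ~ K y -> \val (to_complement y) = y.
Proof. by move=> Ky; apply: insubdK; rewrite inE. Qed.

Lemma to_complementK : cancel \val to_complement.
Proof. by move=> x; apply: val_inj; apply: insubdK; exact: valP. Qed.

Lemma knot_complementP (x : knot_complement K) : ~ K (\val x).
Proof. exact: (set_mem (valP x)). Qed.

Lemma near_complement y : ~ K y -> \forall z \near y, ~ K z.
Proof.
move=> Ky; apply: (@open_nbhs_nbhs _ y (~` K)).
by split=> //; exact: closed_openC.
Qed.

Lemma to_complement_continuous y : ~ K y -> {for y, continuous to_complement}.
Proof.
move=> Ky; apply: continuous_at_set_type.
apply: (@continuous_at_near _ _ id); last by move=> ?.
by have := near_complement Ky; apply: filterS => z /to_complementE.
Qed.

Lemma val_complement_continuous :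
  continuous (\val : knot_complement K -> sphere R 3).
Proof. exact: (@val_set_type_continuous _ (~` K)). Qed.

End complement_map.

Lemma open_embedding_near (X Y : topologicalType) (f : X -> Y) x (P : set X) :
  open_embedding f -> (\forall x' \near x, P x') -> nbhs (f x) (f @` P).
Proof.
move=> [_ _ fo] xP.
have [U [oU Ux] UP] : exists2 U, open_nbhs x U & U `<=` P.
  by have : nbhs x P := xP; rewrite nbhsE.
apply: filterS (open_nbhs_nbhs (conj (fo _ oU) _)); last by exists x.
by move=> _ [x' Ux' <-]; exists x' => //; exact: UP.
Qed.

Section charts.
Context (R : realType) (K : set (sphere R 3)).
Hypothesis cK : closed K.
Context (x0 : knot_complement K) (G : groupType)
  (e : knot_complement K -> knot_complement K -> G).
Hypothesis eP : local_cocycle e.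

Local Notation to_X := (to_complement x0).

(** The chart-free form of [k * k = 1]: it speaks of loops of the complement near [y], so different
    charts around [y] can be compared through it. *)
Definition square_trivial (y : sphere R 3) : Prop := exists2 U, nbhs y U &
  forall g : R -> knot_complement K, continuous g -> g 0 = g 1 ->
    (forall s, U (\val (g s))) -> (transport e g * transport e g = 1)%g.

Section chart.
Context (psi : R * (R * R) -> sphere R 3).
Hypothesis psiP : flat_chart K psi.

Lemma chart_off_knot p : off_axis p -> ~ K (psi p).
Proof. by case: p => t z oz /psiP.2; exact: oz. Qed.

Lemma chart_continuous p : off_axis p -> {for p, continuous (to_X \o psi)}.
Proof.
move=> op; apply: continuous_comp; first by case: psiP => -[c _ _] _; exact: c.
by apply: to_complement_continuous => //; exact: chart_off_knot.
Qed.

Context (u : side -> R * (R * R) -> G) (k : G).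
Hypothesis uk : atlas e (to_X \o psi) u k.

(** The whole image of the chart serves as the neighbourhood: in coordinates the loop avoids the
    axis, and [atlas_loop] applies. *)
Lemma chart_square_trivial t : (k * k = 1)%g -> square_trivial (psi (t, (0, 0))).
Proof.
move=> kk; have [psie psiK] := psiP; have [cpsi ipsi opsi] := psie.
exists (range psi).
  by apply: open_embedding_near => //; exact: filterE.
move=> g cg g01 gU.
have /choice[h hP] : forall s, exists p, psi p = \val (g s).
  by move=> s; have [p _ <-] := gU s; exists p.
have ho s : off_axis (h s).
  move=> h0; apply: (@knot_complementP _ _ (g s)); rewrite -hP.
  by move: h0; case: (h s) => t' z /= ->; exact/psiK.
have gE : g = to_X \o psi \o h.
  by apply/funext => s; rewrite /= hP to_complementK.
have ch : continuous h.
  move=> s U Us; have Uimg := open_embedding_near psie Us.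
  rewrite hP in Uimg.
  have cvg_ : continuous (fun s => \val (g s)).
    exact: (continuous_comp_fun cg (@val_complement_continuous _ K)).
  have := near_continuous (cvg_ s) Uimg; apply: filterS => s' [p Up].
  by rewrite -hP => /ipsi pE /=; rewrite -pE.
have h01 : h 0 = h 1 by apply: ipsi; rewrite !hP g01.
have [w fw] : exists w : R -> G, forall t, flat_at e g w t.
  exact: (flat_total eP cg).
rewrite (transportE eP cg (fun s _ => fw s)).
apply: (atlas_loop uk kk ch ho h01) => s _.
by rewrite -gE.
Qed.

(** The given neighbourhood may be smaller than the chart, so the test loop is a circle of radius
    [r / 2] inside it; its transport is conjugate to [k] whatever the radius. *)
Lemma square_trivial_chart t : square_trivial (psi (t, (0, 0))) -> (k * k = 1)%g.
Proof.
move=> [U yU UP]; have [psie psiK] := psiP; have [cpsi ipsi opsi] := psie.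
have /nbhs_ballP[r /= r0 rP] := near_continuous (cpsi (t, (0, 0))) yU.
have r2 : 0 < r / 2 by rewrite divr_gt0.
pose g s := to_X (psi (circle t (r / 2) (2 * pi * s))).
have cg : continuous g.
  move=> s; apply: (@continuous_comp _ _ _
    (fun s => circle t (r / 2) (2 * pi * s)) (to_X \o psi)).
    have cturn : continuous (fun s : R => 2 * pi * s).
      by apply: continuous_mulR; [exact: cst_continuous|move=> a; exact: cvg_id].
    by apply: (continuous_comp (@cturn s)); exact: circle_continuous.
  by apply: chart_continuous; exact: circle_off_axis.
have g01 : g 0 = g 1.
  by rewrite /g mulr1 mulr0 -[2 * pi]add0r circle_closed.
have gU s : U (\val (g s)).
  rewrite to_complementE; last exact/chart_off_knot/circle_off_axis.
  apply: rP; set a := 2 * pi * s.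
  have small (x : R) : `|x| <= 1 -> `|0 - r / 2 * x| < r.
    move=> x1; rewrite sub0r normrN normrM (gtr0_norm r2).
    by have := ler_wpM2l (ltW r2) x1; lra.
  split; first by rewrite /ball/= subrr normr0.
  split; rewrite /ball/=; apply: small; rewrite ler_norml.
    by rewrite cos_geN1 cos_le1.
  by rewrite sin_geN1 sin_le1.
have := UP g cg g01 gU.
rewrite (circle_transport eP chart_continuous uk t r2 (phi := id))//.
  exact: square_conj.
by move=> a; exact: cvg_id.
Qed.

End chart.

(** Within one chart the property is equivalent to [k * k = 1], which does not involve [t]; it is
    thus locally constant along [K]. *)
Lemma square_trivial_knot : is_knot K ->
  forall y z, K y -> K z -> square_trivial y -> square_trivial z.
Proof.
move=> hK; apply: knot_connected => // y Ky.
have [psi [psiP psi0]] := hK.2 y Ky.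
have [u [k uk]] := atlas_exists eP (chart_continuous psiP).
have st t : square_trivial (psi (t, (0, 0))) = (k * k = 1)%g.
  apply/propext; split; first exact: (square_trivial_chart psiP uk).
  exact: (chart_square_trivial psiP uk).
have : nbhs y (range psi).
  by rewrite -psi0; apply: open_embedding_near; [case: psiP|exact: filterE].
apply: filterS => z [[t w] _ <-] /psiP.2 ->.
by rewrite -psi0 !st.
Qed.

(** [delta] only conjugates, and [mu] is the unit circle of a flat chart, whose transport is
    conjugate to [k]. *)
Lemma meridian_square_trivial (m : pi1 R x0) : is_meridian m ->
  (pi1_holonomy e m * pi1_holonomy e m = 1)%g ->
  exists2 y, K y & square_trivial y.
Proof.
move=> [psi [c [delta [mu [psiP muE ->]]]]].
have [u [k uk]] := atlas_exists eP (chart_continuous psiP).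
rewrite (pi1_holonomyE eP) !(transport_concat eP) (transport_reverse eP) => mm.
exists (psi (0, (0, 0))); first exact/psiP.2.
apply: (chart_square_trivial psiP uk).
pose phi (s : R) : R := \val (toI s).
have pmu : pathR mu = fun s => to_X (psi (circle 0 1 (2 * pi * phi s))).
  apply/funext => s; apply: val_inj.
  rewrite to_complementE; last exact/(chart_off_knot psiP)/circle_off_axis.
  by rewrite /circle !mul1r /pathR muE.
have mumu : (transport e (pathR mu) * transport e (pathR mu) = 1)%g.
  by apply: (@square_conj _ _ (transport e (pathR delta))^-1%g); rewrite invgK.
move: mumu; rewrite pmu.
rewrite (circle_transport eP (chart_continuous psiP) uk 0 ltr01 (phi := phi)).
- exact: square_conj.
- exact: (continuous_comp_fun (@toI_continuous R) (@val_continuous R)).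
- by rewrite /phi toI_le0// val_zero.
- by rewrite /phi toI_ge1// val_one.
Qed.

End charts.

(** * The double branched cover *)

Section branched_cocycle.
Context (R : realType) (K : set (sphere R 3)).
Hypothesis cK : closed K.
Context (x0 : knot_complement K) (G : groupType)
  (e : knot_complement K -> knot_complement K -> G).
Hypothesis eP : local_cocycle e.
Context (Sigma : topologicalType) (p : Sigma -> sphere R 3).
Hypothesis cp : continuous p.
Hypothesis branched : forall y, K y -> branched_at K p y.
Hypothesis square : forall y, K y -> square_trivial e y.

Local Notation to_X := (to_complement x0).
Local Notation proj := (to_X \o p).

Let proj_continuous s : ~ K (p s) -> {for s, continuous proj}.
Proof.
move=> Ks; apply: continuous_comp; first exact: cp.
exact: to_complement_continuous.
Qed.

Let near_off s : ~ K (p s) -> \forall t \near s, ~ K (p t).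
Proof.
move=> /(near_complement cK) Ks.
by have := near_continuous (@cp s) Ks; apply.
Qed.

(** A trivialisation over [V] constrained only off the branch set; its values on the branch set are
    arbitrary. *)
Definition gauge (V : set Sigma) (w : Sigma -> G) : Prop :=
  forall t, V t -> ~ K (p t) -> flat_at e proj w t.

Let branched_chart y : K y -> exists psi psi',
  [/\ flat_chart K psi /\ psi (0, (0, 0)) = y, open_embedding psi',
    range psi' = p @^-1` range psi,
    forall q, p (psi' q) = psi (q.1, complex_square q.2) &
    forall q, off_axis q <-> ~ K (p (psi' q))].
Proof.
move=> /branched[psi [psi' [psi0 psi'e rpsi' pE]]]; exists psi, psi'.
split=> // [[t z]|[t z]]; first exact: pE.
rewrite pE /off_axis /=; have [[_ psiK] _] := psi0.
by split=> [zn /psiK/complex_square_eq0//|Kn /complex_square_eq0/psiK].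
Qed.

(** At a branch point the gauge is the flat function of [squared_flat] carried over by [psi'].
    Elsewhere it is [e] itself, and the last clause records this choice so that the new cocycle
    extends [e]. *)
Let gauge_exists s : exists Vw : set Sigma * (Sigma -> G),
  [/\ nbhs s Vw.1, gauge Vw.1 Vw.2 &
     ~ K (p s) -> Vw.2 = fun t => e (proj s) (proj t)].
Proof.
have [Ks|Ks] := pselect (K (p s)); last first.
  have fs := flat_locally eP (proj_continuous Ks).
  exists ([set t | {for t, continuous proj} -> flat_at e proj
    (fun t' => e (proj s) (proj t')) t], fun t => e (proj s) (proj t)).
  by split=> //= t ft Kt; apply: ft; exact: proj_continuous.
have [psi [psi' [[psiP psi0] psi'e rpsi' pE off]]] := branched_chart Ks.
have [u [k uk]] := atlas_exists eP (chart_continuous cK (x0 := x0) psiP).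
have kk : (k * k = 1)%g.
  apply: (square_trivial_chart cK eP psiP uk (t := 0)).
  by rewrite psi0; exact: square.
have [v fv] := squared_flat eP (chart_continuous cK (x0 := x0) psiP) uk kk.
have /choice[h hP] : forall t, exists q, range psi' t -> psi' q = t.
  move=> t; have [[q _ qt]|nt] := pselect (range psi' t); first by exists q.
  by exists (0, (0, 0)).
have [_ ipsi' opsi'] := psi'e.
have hK q : h (psi' q) = q by apply: ipsi'; apply: hP; exists q.
have rs : range psi' s by rewrite rpsi' /preimage /= -psi0; exists (0, (0, 0)).
exists (range psi', v \o h); split=> //=.
  have [q _ <-] := rs.
  by apply: open_embedding_near => //; exact: filterE.
move=> _ [q _ <-] /off oq; have := open_embedding_near psi'e (fv _ oq).
rewrite /flat_at; apply: filterS => _ [q' vq' <-].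
by rewrite /= !hK vq' !pE.
Qed.

(* The complement of the branch set is locally connected near the branch set,
   so that flat functions there are determined up to a constant. *)
Let gauge_compare (t : Sigma) (V V' : set Sigma) (w w' : Sigma -> G) : nbhs t V -> nbhs t V' -> gauge V w ->
  gauge V' w' -> exists g, \forall t' \near t, ~ K (p t') -> w t' = (g * w' t')%g.
Proof.
move=> tV tV' gw gw'; have [Kt|Kt] := pselect (K (p t)); last first.
  exists (w t * (w' t)^-1)%g.
  have fw := gw _ (nbhs_singleton tV) Kt; have fw' := gw' _ (nbhs_singleton tV') Kt.
  have := flat_quotient fw fw'.
  by apply: filterS => t' <- _; rewrite mulgVK.
have [psi [psi' [[psiP psi0] psi'e rpsi' pE off]]] := branched_chart Kt.
have [q _ qt] : range psi' t by rewrite rpsi' /preimage /= -psi0; exists (0, (0, 0)).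
have q0 : q.2 = (0, 0).
  by apply: contrapT => /off; rewrite qt.
have [cpsi' ipsi' opsi'] := psi'e.
have /nbhs_ballP[r /= r0 rP] : \forall q' \near q, V (psi' q') /\ V' (psi' q').
  apply: (near_continuous (P := fun t => V t /\ V' t) (@cpsi' q)).
  by rewrite qt; exact: filterI.
pose d q' := (w (psi' q') * (w' (psi' q'))^-1)%g.
have dE i q1 q2 : ball q r q1 -> ball q r q2 -> 0 < height i q1 ->
    0 < height i q2 -> d q1 = d q2.
  move=> b1 b2 h1 h2.
  have seg s : 0 <= s <= 1 -> [/\ V (psi' (q1 + s *: (q2 - q1))),
      V' (psi' (q1 + s *: (q2 - q1))) & ~ K (p (psi' (q1 + s *: (q2 - q1))))].
    move=> s01; have [|V1 V2] := rP (q1 + s *: (q2 - q1)).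
      have -> : q1 + s *: (q2 - q1) = (1 - s) *: q1 + s *: q2.
        by rewrite scalerBr scalerBl scale1r addrA addrAC.
      exact: ball_segment.
    by split=> //; apply/off/height_off_axis; exact: (height_convex h1 h2 s01).
  apply: (@flat_quotient_segment _ _ _ e _ (proj \o psi') (w \o psi') (w' \o psi')).
    move=> s /seg[Vs _ Ks]; apply: flat_comp; first exact: cpsi'.
    exact: gw.
  move=> s /seg[_ Vs Ks]; apply: flat_comp; first exact: cpsi'.
  exact: gw'.
(* One sample point in each quadrant of the ball; consecutive ones share a half-space and so link
   the half-balls together. *)
pose corner (a b : R) := (q.1, (a * (r / 2), b * (r / 2))).
have cornerb (a b : R) : `|a| <= 1 -> `|b| <= 1 -> ball q r (corner a b).
  have r2 : 0 < r / 2 by rewrite divr_gt0.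
  have small (x : R) : `|x| <= 1 -> `|0 - x * (r / 2)| < r.
    move=> x1; rewrite sub0r normrN normrM (gtr0_norm r2).
    by have := ler_wpM2r (ltW r2) x1; lra.
  move=> a1 b1; rewrite /corner; split; first by rewrite /ball/= subrr normr0.
  by rewrite q0; split; exact: small.
have r2 : 0 < r / 2 by rewrite divr_gt0.
have n1 : `|1 : R| <= 1 by rewrite normr1.
have nN1 : `|-1 : R| <= 1 by rewrite normrN normr1.
have ENE : d (corner 1 1) = d (corner 1 (-1)).
  by apply: (dE East); rewrite /height /= ?mul1r//; exact: cornerb.
have WNE : d (corner (-1) 1) = d (corner (-1) (-1)).
  by apply: (dE West); rewrite /height /= ?mulN1r ?opprK//; exact: cornerb.
have NEW : d (corner 1 1) = d (corner (-1) 1).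
  by apply: (dE North); rewrite /height /= ?mul1r//; exact: cornerb.
have all_d i q' : ball q r q' -> 0 < height i q' -> d q' = d (corner 1 1).
  case: i => bq hq.
  - by apply: (dE East) => //; [exact: cornerb|rewrite /height /= mul1r].
  - by apply: (dE North) => //; [exact: cornerb|rewrite /height /= mul1r].
  - rewrite NEW; apply: (dE West) => //; first exact: cornerb.
    by rewrite /height /= mulN1r opprK.
  - rewrite ENE; apply: (dE South) => //; first exact: cornerb.
    by rewrite /height /= mulN1r opprK.
exists (d (corner 1 1)).
have := open_embedding_near psi'e (nbhsx_ballx q r r0); rewrite qt.
apply: filterS => _ [q' bq' <-] /off/off_axis_height[i hi].
by rewrite -(all_d i q' bq' hi) /d mulgVK.
Qed.

(** Density of the complement of the branch set, which makes the comparison constants unique. *)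
Let near_off_knot (t : Sigma) (N : set Sigma) : nbhs t N -> exists2 t', N t' & ~ K (p t').
Proof.
move=> tN; have [Kt|Kt] := pselect (K (p t)); last first.
  by exists t => //; exact: nbhs_singleton.
have [psi [psi' [[psiP psi0] psi'e rpsi' pE off]]] := branched_chart Kt.
have [q _ qt] : range psi' t by rewrite rpsi' /preimage /= -psi0; exists (0, (0, 0)).
have q0 : q.2 = (0, 0) by apply: contrapT => /off; rewrite qt.
have [cpsi' _ _] := psi'e; rewrite -qt in tN.
have /nbhs_ballP[r /= r0 rP] := near_continuous (@cpsi' q) tN.
have r2 : 0 < r / 2 by rewrite divr_gt0.
exists (psi' (q.1, (r / 2, 0))).
  apply: rP; split; first by rewrite /ball/= subrr normr0.
  rewrite q0; split; rewrite /ball/= ?subrr ?normr0// sub0r normrN gtr0_norm//.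
  lra.
by apply/off => -[/eqP]; rewrite gt_eqF.
Qed.

(** [c s t] is the constant relating the gauges at [s] and [t] near [t], off the branch set.
    Uniqueness of that constant yields both the cocycle rule and the agreement with [e]. *)
Lemma branched_cocycle : exists2 c : Sigma -> Sigma -> G, local_cocycle c &
  forall s, ~ K (p s) -> \forall t \near s, c s t = e (proj s) (proj t).
Proof.
have /choice[Vw hVw] := gauge_exists.
pose rel (s t : Sigma) (g : G) := \forall t' \near t, ~ K (p t') -> (Vw s).2 t' = (g * (Vw t).2 t')%g.
pose c s t := if pselect (exists g, rel s t g) is left h then sval (cid h) else 1%g.
have cE s t g : rel s t g -> c s t = g.
  move=> rg; rewrite /c; case: pselect => [h|[]]; last by exists g.
  case: cid => g' rg' /=.
  have [t' [r1 r2] Kt'] := near_off_knot (filterI rg rg').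
  by apply: (@mulIg _ ((Vw t).2 t')); rewrite -r1// -r2.
have crel s t : nbhs t (Vw s).1 -> rel s t (c s t).
  move=> tV; have [tVt gt _] := hVw t; have [_ gs _] := hVw s.
  by have [g rg] := gauge_compare tV tVt gs gt; rewrite (cE _ _ _ rg).
exists c => [s|s Ks].
  have [sVs _ _] := hVw s.
  have := nbhs_interior sVs; apply: filterS => t tVs.
  have [tVt _ _] := hVw t.
  have r1 := nbhs_interior (crel _ _ tVs).
  have r2 := nbhs_interior tVt.
  move: r1 r2; apply: filterS2 => t' r1 r2; apply: cE.
  have r3 := crel _ _ r2; move: r1 r3; rewrite /rel.
  by apply: filterS2 => t'' e1 e2 Kt''; rewrite e1// e2// mulgA.
have [_ _ ws] := hVw s.
have n1 := near_continuous (@proj_continuous s Ks) (eP (proj s)).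
move: n1 (near_off Ks); apply: filterS2 => t e1 Kt; apply: cE.
have [_ _ wt] := hVw t; rewrite /rel ws// wt//.
have := near_continuous (@proj_continuous t Kt) e1.
by apply: filterS => t' e2 _.
Qed.

End branched_cocycle.

(** * Path lifting over the complement of the knot *)

Section path_lifting.
Context (R : realType) (K : set (sphere R 3)) (Sigma : topologicalType)
  (p : Sigma -> sphere R 3).
Hypothesis sheets : forall y, ~ K y -> two_sheeted_at p y.

(** The inverse of [p] on a sheet, made total by the value [s0] outside [U]; it is continuous
    because [p] is open on the sheet. *)
Lemma sheet_section (s0 : Sigma) V U : homeomorphism_onto p V U ->
  exists i : sphere R 3 -> Sigma, [/\ forall y, U y -> p (i y) = y,
    forall s, V s -> i (p s) = s & forall y, U y -> {for y, continuous i}].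
Proof.
move=> [oV [pU injp surjp] _ pV].
have /choice[i iP] : forall y, exists s, U y -> V s /\ p s = y.
  move=> y; have [Uy|nU] := pselect (U y); last by exists s0.
  by have [s Vs sy] := surjp _ Uy; exists s.
have iK s : V s -> i (p s) = s.
  move=> Vs; have Up := pU _ Vs; have [Vi pi_] := iP _ Up.
  by apply: injp => //; rewrite inE.
exists i; split=> [y /iP[]//|//|y Uy O iO].
have [Vi pi_] := iP _ Uy.
have oVO : open (V `&` O°) by apply: openI => //; exact: open_interior.
have : nbhs y (p @` (V `&` O°)).
  apply: open_nbhs_nbhs; split; first by apply: pV => // s [].
  by exists (i y).
by apply: filterS => _ [s [Vs Os] <-] /=; rewrite iK//; exact: interior_subset.
Qed.

Lemma line_lift (g : R -> sphere R 3) (s0 : Sigma) : continuous g ->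
  (forall t, ~ K (g t)) -> p s0 = g 0 ->
  exists h : R -> Sigma, [/\ continuous h, h 0 = s0 &
    forall t, 0 <= t <= 1 -> p (h t) = g t].
Proof.
move=> cg gK.
(* Quantifying over the starting point lets successive lifts be chained. *)
pose P (a b : R) := forall s, p s = g a -> exists h : R -> Sigma,
  [/\ continuous h, h a = s & forall t, a <= t <= b -> p (h t) = g t].
suff : P 0 1 by apply.
apply: interval_induction; first exact: ler01.
- move=> a m b _ am mb _ P1 P2 s sa.
  have [h1 [ch1 h1a ph1]] := P1 _ sa.
  have [|h2 [ch2 h2m ph2]] := P2 (h1 m); first by rewrite ph1// am lexx.
  exists (fun t => if t <= m then h1 t else h2 t); split.
  + apply: (glue_continuous (u := id)) => // [t|t ->]; first exact: cvg_id.
    by rewrite h2m.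
  + by rewrite am.
  + move=> t /andP[at_ tb]; case: (leP t m) => tm.
      by rewrite ph1// at_.
    by rewrite ph2// ltW.
- move=> t _; have [U [V [V' [[oU Ut] _ VV' hV hV']]]] := sheets (gK t).
  have /nbhs_ballP[r /= r0 rU] : nbhs t (g @^-1` U).
    by apply: (near_continuous (@cg t)); exact: open_nbhs_nbhs.
  exists (ball t r); first exact: nbhsx_ballx.
  move=> a b ra rb at_ tb _ _ s sa.
  have [W [Ws hW]] : exists W, W s /\ homeomorphism_onto p W U.
    have : (V `|` V') s by rewrite VV' /preimage/= sa; exact: rU.
    by case=> [Vs|Vs]; [exists V|exists V'].
  have [i [pi_ iK ci]] := sheet_section s0 hW.
  (* The lift must be continuous on the whole line, whereas [g] is known to stay in [U] only near
     [t]. *)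
  pose clamp (x : R) := Num.max a (Num.min b x).
  have clampU x : U (g (clamp x)).
    apply: rU; move: ra rb; rewrite /ball/= !ltr_norml => ra rb.
    have : a <= clamp x <= b.
      by rewrite /clamp le_max lexx/= ge_max ge_min lexx (le_trans at_ tb).
    by move=> cx; apply/andP; lra.
  have cclamp : continuous clamp.
    apply: continuous_maxR; first exact: cst_continuous.
    by apply: continuous_minR; [exact: cst_continuous|move=> x; exact: cvg_id].
  have clampK x : a <= x <= b -> clamp x = x.
    by move=> /andP[ax xb]; rewrite /clamp min_r// max_r.
  exists (i \o g \o clamp); split.
  + move=> x; apply: continuous_comp; first exact: cclamp.
    by apply: continuous_comp; [exact: cg|exact: ci].
  + have ab : a <= a <= b by rewrite lexx (le_trans at_ tb).
    by rewrite /comp (clampK _ ab) -sa (iK _ Ws).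
  + by move=> x xab; rewrite /comp (pi_ _ (clampU x)) clampK.
Qed.

Definition lifts x y s s' (h : {path I01 R from s to s'})
    (f : {path I01 R from x to y in knot_complement K}) : Prop :=
  forall t, p (pathR h t) = \val (pathR f t).

Lemma path_lift x y (f : {path I01 R from x to y in knot_complement K}) s :
  p s = \val x -> exists s' (h : {path I01 R from s to s'}), lifts h f.
Proof.
move=> sx; have cf : continuous (fun t => \val (pathR f t)).
  exact: (continuous_comp_fun (@pathR_continuous _ _ _ _ f)
    (@val_complement_continuous _ K)).
have [|||h [ch h0 hP]] := line_lift (g := fun t => \val (pathR f t)) (s0 := s).
- exact: cf.
- by move=> t; exact: knot_complementP.
- by rewrite pathR_le0.
exists (h 1).
have cv : continuous (h \o (\val : I01 R -> R)).
  exact: (continuous_comp_fun (@val_continuous R) ch).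
have v0 : (h \o (\val : I01 R -> R)) zero = s by rewrite /comp val_zero.
have v1 : (h \o (\val : I01 R -> R)) one = h 1 by rewrite /comp val_one.
exists (mk_path cv v0 v1) => t.
rewrite {1}/pathR [X in p X]/= /mk_path /comp hP; last exact: I01P.
by rewrite pathR_val.
Qed.

Lemma lifts_concat x y z s1 s2 s3 (h1 : {path I01 R from s1 to s2})
    (h2 : {path I01 R from s2 to s3})
    (f1 : {path I01 R from x to y in knot_complement K})
    (f2 : {path I01 R from y to z in knot_complement K}) :
  lifts h1 f1 -> lifts h2 f2 -> lifts (concat h1 h2) (concat f1 f2).
Proof. by move=> l1 l2 t; rewrite !pathR_concat; case: ifP. Qed.

Lemma lifts_reverse x y s s' (h : {path I01 R from s to s'})
    (f : {path I01 R from x to y in knot_complement K}) :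
  lifts h f -> lifts (reverse h) (reverse f).
Proof. by move=> l t; rewrite !pathR_reverse. Qed.

Lemma lifts_end x y s s' (h : {path I01 R from s to s'})
    (f : {path I01 R from x to y in knot_complement K}) :
  lifts h f -> p s' = \val y.
Proof. by move=> /(_ 1); rewrite !pathR_ge1. Qed.

Lemma fibre_nonempty y : ~ K y -> exists s, p s = y.
Proof.
move=> /sheets[U [V [V' [[_ Uy] _ _ [_ [_ _ sur] _ _] _]]]].
by have [s _ sy] := sur _ Uy; exists s.
Qed.

Lemma fibre_two y s0 s1 s2 : ~ K y -> p s0 = y -> p s1 = y -> p s2 = y ->
  s1 <> s0 -> s2 <> s0 -> s1 = s2.
Proof.
move=> /sheets[U [V [V' [[_ Uy] _ VV' [_ [_ inj _] _ _] [_ [_ inj' _] _ _]]]]].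
move=> p0 p1 p2 s10 s20.
have sV s : p s = y -> V s \/ V' s.
  by move=> ps; have : (V `|` V') s by rewrite VV' /preimage/= ps.
have e s s' : V s -> V s' -> p s = y -> p s' = y -> s = s'.
  by move=> Vs Vs' ps ps'; apply: inj; rewrite ?inE// ps.
have e' s s' : V' s -> V' s' -> p s = y -> p s' = y -> s = s'.
  by move=> Vs Vs' ps ps'; apply: inj'; rewrite ?inE// ps.
case: (sV _ p0) (sV _ p1) (sV _ p2) => v0 [] v1 [] v2.
all: by [exact: e|exact: e'|case: s10; exact: e|case: s10; exact: e'|
  case: s20; exact: e|case: s20; exact: e'].
Qed.

Section lifted_transport.
Context (G : groupType) (e : knot_complement K -> knot_complement K -> G)
  (c : Sigma -> Sigma -> G).
Hypotheses (eP : local_cocycle e) (cP : local_cocycle c).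
Context (x0 : knot_complement K).
Hypothesis ce : forall s, ~ K (p s) -> \forall t \near s,
  c s t = e (to_complement x0 (p s)) (to_complement x0 (p t)).

(** A flat function along [f] is also flat along its lift, since [c] reads as [e] off the branch
    set. *)
Lemma lifted_transport x y s s' (h : {path I01 R from s to s'})
    (f : {path I01 R from x to y in knot_complement K}) :
  lifts h f -> transport c (pathR h) = transport e (pathR f).
Proof.
move=> hf; have ch := @pathR_continuous _ _ _ _ h.
have cf := @pathR_continuous _ _ _ _ f.
have [w fw] : exists w : R -> G, forall t, flat_at e (pathR f) w t.
  exact: (flat_total eP cf).
rewrite (transportE eP cf (fun t _ => fw t)).
apply: (transportE cP ch) => t _.
have toX t' : to_complement x0 (p (pathR h t')) = pathR f t'.
  by rewrite hf to_complementK.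
have Kt : ~ K (p (pathR h t)) by rewrite hf; exact: knot_complementP.
have := near_continuous (@ch t) (ce Kt).
by move: (fw t); apply: filterS2 => t' wt'; rewrite !toX => ->.
Qed.

End lifted_transport.

End path_lifting.

(** * Rotations *)

Section rotations.
Context (R : realType).
Implicit Types (A : SO3 R) (v w : 'cV[R]_3).

(** Odd dimension: [A - 1 = A (1 - A^T)] gives [det (A - 1) = det (1 - A) = - det (A - 1)]. *)
Lemma so3_axis A : exists2 v : 'cV[R]_3, v != 0 & A *m v = v.
Proof.
have detA1 : \det (so3_val A - 1%:M) = 0.
  have e : \det (so3_val A - 1%:M) = \det (1%:M - so3_val A).
    have -> : so3_val A - 1%:M = A *m (1%:M - A^T).
      by rewrite mulmxBr mulmx1 so3_orthC.
    by rewrite det_mulmx so3_det mul1r -det_tr linearB /= trmxK trmx1.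
  move: e; rewrite -[1%:M - _]opprB -[- (_ - _)]scaleN1r detZ.
  have -> : (-1) ^+ 3 = -1 :> R by ring.
  by rewrite mulN1r => /eqP; rewrite -addr_eq0 -mulr2n mulrn_eq0 => /eqP.
have /eqP/det0P[v v0 vA] : \det (so3_val A - 1%:M)^T = 0 by rewrite det_tr.
exists v^T; first by rewrite -(inj_eq trmx_inj) trmxK trmx0.
apply/eqP; rewrite -subr_eq0 -[X in _ - X]mul1mx -mulmxBl.
by rewrite -(inj_eq trmx_inj) trmx_mul trmxK vA trmx0.
Qed.

(** [n] is the cross product of [v] and [w], characterised by [det (M x) = n^T x]. As [A] has
    determinant 1 and fixes [v] and [w], it fixes [n], hence a basis. *)
Lemma so3_fix_plane A v w : A *m v = v -> A *m w = w -> v != 0 ->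
  (forall l, w <> l *: v) -> A = 1%g.
Proof.
move=> Av Aw v0 vw.
pose M (x : 'cV[R]_3) : 'M[R]_3 := \matrix_(i, j) [:: x i 0; v i 0; w i 0]`_j.
pose n : 'cV[R]_3 := \col_i [:: v 1 0 * w 2%:R 0 - w 1 0 * v 2%:R 0;
  w 0 0 * v 2%:R 0 - v 0 0 * w 2%:R 0; v 0 0 * w 1 0 - w 0 0 * v 1 0]`_i.
have detM (x : 'cV[R]_3) : \det (M x) = (n^T *m x) 0 0.
  by rewrite det3E !mxE sum3E !mxE /=; ring.
have AM (x : 'cV[R]_3) : A *m M x = M (A *m x).
  apply/matrixP => i; apply: forall3.
  - by rewrite !mxE; apply: eq_bigr => j _; rewrite !mxE.
  - by rewrite !mxE /= -[in RHS]Av !mxE; apply: eq_bigr => j _; rewrite !mxE.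
  - by rewrite !mxE /= -[in RHS]Aw !mxE; apply: eq_bigr => j _; rewrite !mxE.
have nA : n^T *m A = n^T.
  apply/rowP => i; have := detM (A *m delta_mx i 0).
  by rewrite -AM det_mulmx so3_det mul1r detM !mulmxA -!colE !mxE => ->.
have An : A *m n = n.
  by rewrite -[in LHS](trmxK n) -nA trmx_mul trmxK mulmxA so3_orthC mul1mx.
have n0 : n != 0.
  apply/negP => /eqP/colP n0.
  have cross i j : v i 0 * w j 0 = w i 0 * v j 0.
    have [n00 n10 n20] : [/\ v 1 0 * w 2%:R 0 = w 1 0 * v 2%:R 0,
        v 0 0 * w 2%:R 0 = w 0 0 * v 2%:R 0 & v 0 0 * w 1 0 = w 0 0 * v 1 0].
      have := n0 0; have := n0 1; have := n0 2%:R; rewrite !mxE /=.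
      by move=> e2 e1 e0; split; lra.
    by move: i j; apply: forall3; apply: forall3 => //; rewrite mulrC //;
      rewrite [RHS]mulrC.
  have [i vi] : exists i, v i 0 != 0.
    apply: contrapT => nv; case/negP: v0; apply/eqP/colP => i; rewrite mxE.
    by apply: contrapT => /eqP vi; apply: nv; exists i.
  apply: (vw (w i 0 / v i 0)); apply/colP => j; rewrite mxE.
  by rewrite mulrAC -cross mulrAC mulfV// mul1r.
have MU : M n \in unitmx.
  rewrite unitmxE unitfE detM !mxE.
  under eq_bigr do rewrite mxE -expr2.
  apply: contraNneq n0 => /eqP; rewrite psumr_eq0 => [/allP n2|i _]; last exact: sqr_ge0.
  apply/eqP/colP => i; rewrite [RHS]mxE; apply/eqP; rewrite -sqrf_eq0.
  by apply: n2; rewrite mem_index_enum.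
apply: so3_inj; have := AM n; rewrite An => /(congr1 (mulmx^~ (invmx (M n)))).
by rewrite mulmxK// mulmxV.
Qed.

Definition orthogonal_plane v : {vspace 'cV[R]_3} :=
  lker (linfun (mulmx v^T : 'cV[R]_3 -> 'M[R]_1)).

Lemma mem_orthogonal_plane v x : (x \in orthogonal_plane v) = (v^T *m x == 0).
Proof. by rewrite memv_ker lfunE. Qed.

Lemma dim_orthogonal_plane v : v != 0 -> (\dim (orthogonal_plane v) = 2)%N.
Proof.
move=> v0; have := limg_ker_dim (linfun (mulmx v^T : 'cV[R]_3 -> 'M[R]_1)) fullv.
rewrite capfv -/(orthogonal_plane v) dimvf /dim /=.
set L := (\dim (limg _)).
have : (L <= 1)%N by apply: leq_trans (dimvS (subvf _)) _; rewrite dimvf /dim /=.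
have : (L != 0)%N.
  rewrite dimv_eq0; apply/negP => /eqP L0.
  have : linfun (mulmx v^T : 'cV[R]_3 -> 'M[R]_1) v \in (0%VS : {vspace 'M[R]_1}).
    by rewrite -L0 memv_img// memvf.
  rewrite memv0 lfunE /= => /eqP/matrixP/(_ 0 0); rewrite !mxE.
  under eq_bigr do rewrite mxE -expr2.
  move=> /eqP; rewrite psumr_eq0 => [/allP v2|i _]; last exact: sqr_ge0.
  case/negP: v0; apply/eqP/colP => i; rewrite [RHS]mxE; apply/eqP.
  by rewrite -sqrf_eq0; apply: v2; rewrite mem_index_enum.
by case: L => [|[|]]// _ _; rewrite addn1 => -[].
Qed.

(** Orthogonality makes [v] an eigenvector of [A^T] too, with eigenvalue [l^-1]. *)
Lemma orthogonal_plane_stable A v l : v != 0 -> A *m v = l *: v ->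
  dihedral_subgroup (orthogonal_plane v) A.
Proof.
move=> v0 Av x; rewrite !mem_orthogonal_plane => /eqP vx.
have vE : v = l *: (A^T *m v).
  by rewrite scalemxAr -Av mulmxA so3_orth mul1mx.
have l0 : l != 0 by apply: contraNneq v0 => l0; rewrite vE l0 scale0r.
have -> : v^T *m (A *m x) = l^-1 *: (v^T *m x).
  rewrite [in RHS]vE linearZ /= -scalemxAl scalerA mulVf// scale1r.
  by rewrite trmx_mul trmxK mulmxA.
by rewrite vx scaler0.
Qed.

(* S has index at most two, hence is normal, so that the whole group permutes
   the common axis of the rotations in f S. *)
Lemma index_two_dihedral (G : groupType) (f : {multiplicative G -> SO3 R})
    (S : set G) v :
  S 1%g -> (forall a b, S a -> S b -> S (a * b)%g) ->
  (forall a, S a -> S a^-1%g) ->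
  (forall a b, ~ S a -> ~ S b -> S (a * b^-1)%g) ->
  v != 0 -> (forall a, S a -> f a *m v = v) -> dihedral f.
Proof.
move=> S1 SM SV S2 v0 fv.
have Sconj a h : S a -> S (h^-1 * a * h)%g.
  move=> Sa; have [Sh|Sh] := pselect (S h).
    by apply: (SM) => //; apply: (SM) => //; exact: SV.
  have Sh1 : ~ S h^-1%g by move=> /SV; rewrite invgK.
  (* The conjugate is the quotient of [h^-1 * a] by [h^-1], both outside [S]. *)
  rewrite -[X in S (_ * X)%g]invgK; apply: S2 => // /(SM _ a^-1%g).
  by move=> /(_ (SV _ Sa)); rewrite mulgK.
suff [x x0 fx] : exists2 x : 'cV[R]_3, x != 0 & forall a, exists l, f a *m x = l *: x.
  exists (orthogonal_plane x); split; first exact: dim_orthogonal_plane.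
  by move=> _ [a _ <-]; have [l fl] := fx a; exact: orthogonal_plane_stable fl.
(* By normality [f s] fixes both [v] and [f h *m v]. Were these independent, [f s] would be 1, so
   [f h] preserves the line of [v]. *)
have [[s Ss fs]|triv] := pselect (exists2 s, S s & f s <> 1%g).
  exists v => // h; apply: contrapT => hl; apply: fs.
  apply: (@so3_fix_plane _ v (f h *m v)) => // [||l fl].
  - exact: fv.
  - have fE a b : f (a * b)%g = f a *m f b :> 'M[R]_3 by rewrite gmulfM.
    have -> : f s *m (f h *m v) = f (h * (h^-1 * s * h))%g *m v.
      by rewrite mulmxA -fE !mulgA mulgV mul1g.
    by rewrite fE -mulmxA (fv _ (Sconj _ h Ss)).
  - by apply: hl; exists l.
(* Degenerate case: [f] is trivial on [S] and takes a single value outside it, whose axis serves in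
   place of [v]. *)
have f1 s : S s -> f s = 1%g.
  by move=> Ss; apply: contrapT => fs; apply: triv; exists s.
have [[g Sg]|allS] := pselect (exists g, ~ S g); last first.
  exists v => // a; exists 1; rewrite scale1r; apply: fv.
  by apply: contrapT => Sa; apply: allS; exists a.
have [x x0 gx] := so3_axis (f g); exists x => // a; exists 1; rewrite scale1r.
have [Sa|Sa] := pselect (S a); first by rewrite f1//= mul1mx.
have -> : f a = f g; last by [].
by rewrite -[a](mulgVK g) gmulfM f1 ?mul1g//; exact: S2.
Qed.

End rotations.

Section unit_quaternions.
Context (R : realType).

Lemma su2_to_so3_i2 : su2_to_so3 (su2_i R * su2_i R)%g = 1%g.
Proof.
apply: so3_inj; apply/matrixP; apply: forall3; apply: forall3;
  rewrite !mxE /= !mxE /=; ring.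
Qed.

(** [i * i = -1] lies in the kernel of the double covering. *)
Lemma traceless_square (G : groupType) (rho : {multiplicative G -> SU2 R})
    (m : G) u : rho m = (su2_i R ^ u)%g -> su2_to_so3 (rho (m * m)%g) = 1%g.
Proof.
move=> rm; rewrite gmulfM rm -conjMg conjgE su2_to_so3M su2_to_so3M su2_to_so3_i2 mul1g.
by rewrite (multiplicativeV (@su2_to_so3 R)) mulVg.
Qed.

End unit_quaternions.

Section fixed_vectors.
Context (R : realType) (v : 'cV[R]_3).
Implicit Types A B : SO3 R.

Lemma so3_fixV A : A *m v = v -> (A^-1)%g *m v = v.
Proof. by move=> Av; rewrite -[in LHS]Av mulmxA so3_orth mul1mx. Qed.

Lemma so3_fixX A n : A *m v = v -> (A ^+ n)%g *m v = v.
Proof.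
move=> Av; elim: n => [|n IHn]; first exact: mul1mx.
by rewrite expgS [so3_val _]/= -mulmxA IHn.
Qed.

End fixed_vectors.

(** * Loops with closed lifts, and the conclusion *)

Section main.
Context (R : realType) (K : set (sphere R 3)) (Sigma : topologicalType)
  (p : Sigma -> sphere R 3).
Hypotheses (sheets : forall y, ~ K y -> two_sheeted_at p y).
Context (x0 : knot_complement K) (b0 : Sigma).
Hypothesis pb0 : p b0 = \val x0.

(** Asking for one representative with a closed lift, rather than for all, keeps the subgroup
    properties and the index bound within the lifting of single paths. *)
Definition lifts_closed (a : pi1 R x0) : Prop :=
  exists2 f, a = homotopy_class f & exists h : {path I01 R from b0 to b0}, lifts p h f.

Lemma lifts_closed1 : lifts_closed 1%g.
Proof.
exists (const_path R x0) => //; exists (const_path R b0) => t.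
by rewrite /pathR.
Qed.

Lemma lifts_closedM a b : lifts_closed a -> lifts_closed b -> lifts_closed (a * b)%g.
Proof.
move=> [f -> [h hf]] [f' -> [h' hf']]; exists (concat f f').
  by rewrite homotopy_classM.
by exists (concat h h'); exact: lifts_concat.
Qed.

Lemma lifts_closedV a : lifts_closed a -> lifts_closed a^-1%g.
Proof.
move=> [f -> [h hf]]; exists (reverse f); first by rewrite homotopy_classV.
by exists (reverse h); exact: lifts_reverse.
Qed.

(** Both lifts end at the other point of the fibre, so one followed by the reverse of the other
    closes up. *)
Lemma lifts_closed_index2 a b : ~ lifts_closed a -> ~ lifts_closed b ->
  lifts_closed (a * b^-1)%g.
Proof.
elim/pi1_ind: a => f; elim/pi1_ind: b => f' nf nf'.
have [s [h hf]] := path_lift sheets f pb0.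
have [s' [h' hf']] := path_lift sheets f' pb0.
have sb0 : s <> b0 by move=> e; apply: nf; exists f => //; subst s; exists h.
have s'b0 : s' <> b0 by move=> e; apply: nf'; exists f' => //; subst s'; exists h'.
have ss' : s = s'.
  apply: (fibre_two sheets _ pb0 _ _ sb0 s'b0); first exact: knot_complementP.
    exact: lifts_end hf.
  exact: lifts_end hf'.
subst s'; exists (concat f (reverse f')).
  by rewrite -homotopy_classM -homotopy_classV.
exists (concat h (reverse h')); apply: lifts_concat => //.
exact: lifts_reverse.
Qed.

End main.

Theorem proposition3p1 (R : realType) (K : set (sphere R 3)) (hK : is_knot K)
    (Sigma : topologicalType) (p : Sigma -> sphere R 3)
    (hp : double_branched_cover K p) (b : Sigma)
    (hcyclic : forall f : {multiplicative pi1 R b -> SO3 R}, cyclic_image f) :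
  SU2_simple K.
Proof.
move=> x0 m hm rho [u rho_m]; have [connS cp sheets branched] := hp.
have cK := knot_closed hK.
pose alpha : {multiplicative pi1 R x0 -> SO3 R} := (@su2_to_so3 R \o rho)%FUN.
have [e [k [eP eE]]] := representation_cocycle alpha
  (knot_complement_locally_path_connected cK)
  (knot_complement_semilocally_simply_connected cK).
have hol_e a : pi1_holonomy e a = (alpha a ^ k)%g.
  by elim/pi1_ind: a => f; rewrite pi1_holonomyE// eE.
have square y : K y -> square_trivial e y.
  have [|z Kz sz] := meridian_square_trivial cK eP hm.
    rewrite !hol_e -conjMg -gmulfM.
    by rewrite [alpha _](traceless_square rho_m) conj1g.
  by move=> Ky; exact: (square_trivial_knot cK x0 eP hK Kz Ky).
have [c cP ce] := branched_cocycle cK x0 eP cp branched square.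
pose hol : {multiplicative pi1 R b -> SO3 R} := HB.pack_for
  {multiplicative pi1 R b -> SO3 R} (@pi1_holonomy R Sigma (SO3 R) c b)
  (isMultiplicative.Build _ _ _ (@pi1_holonomyM _ _ _ _ cP b)).
have [r r_range] := hcyclic hol.
have [v v0 rv] := so3_axis r.
(* Cyclicity is given at [b], whereas loops at [x0] lift to paths starting above [x0]; [beta] joins
   the two base points. *)
have [b0 pb0] := fibre_nonempty sheets (@knot_complementP _ _ x0).
have [beta _] := connS b b0.
(* [k] accounts for the conjugation in [eE] and [beta] for the change of base point: conjugation by
   [q] turns the holonomy at [b] into [alpha], and the axis [v] into [q *m v]. *)
pose q := (k * (transport c (pathR beta))^-1)%g.
apply: (@index_two_dihedral _ _ alpha (lifts_closed p (x0 := x0) b0) (q *m v)).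
- exact: lifts_closed1.
- exact: lifts_closedM.
- exact: lifts_closedV.
- exact: lifts_closed_index2.
- apply: contraNneq v0 => qv.
  by rewrite -[v]mul1mx -(so3_orth q) -mulmxA qv mulmx0.
move=> _ [f -> [h hf]].
pose a := homotopy_class (concat (concat beta h) (reverse beta)).
have holv : hol a *m v = v.
  have : range hol (hol a) by exists a.
  rewrite r_range => -[n [->|->]]; first exact: so3_fixX.
  by apply: so3_fixV; exact: so3_fixX.
have hola : hol a = (q^-1 * alpha (homotopy_class f) * q)%g.
  rewrite [hol a](pi1_holonomyE cP) !(transport_concat cP) (transport_reverse cP).
  rewrite (lifted_transport eP cP ce hf) eE conjgE /q.
  by move: (transport c (pathR beta)) => t; rewrite invgM invgK !mulgA.
have fq : (alpha (homotopy_class f) * q = q * hol a)%g.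
  by rewrite hola !mulgA mulgV mul1g.
have qE (A B : SO3 R) : A *m (B *m v) = (A * B)%g *m v by rewrite mulmxA.
by rewrite qE fq -qE holv.
Qed.
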